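(* Let $A$ be a noetherian commutative ring in which $2$ is invertible, let $n\ge1$, let $f(u)=\sum_{i=0}^na_{2n-2i}u^{2i}\in A[u]$ with $a_0=1$, let $\alpha\in A$ satisfy $\alpha^2=(-1)^na_{2n}$, let $B$ be the type D splitting ring of $(f,\alpha)$, and let $\bar\Delta\in A$ and $V(\bar\Delta,\partial\bar\Delta)\subset\operatorname{Spec}(A)$ be as in the context. Suppose that (a) $A$ is normal, (b) $\bar\Delta$ is a non-zerodivisor, (c) $V(\bar\Delta,\partial\bar\Delta)$ has codimension $\ge2$. Then $\bar\Delta$ is squarefree and $B$ is normal.
   Context: The type D splitting ring is $B=\operatorname{DSplit}_A(f,\alpha)=A[\eta_1,\dots,\eta_n]/I$, where $I$ is generated by $a_{2i}-(-1)^ie_i(\eta_1^2,\dots,\eta_n^2)$ for $1\le i\le n-1$ and $\eta_1\cdots\eta_n-\alpha$ (so that $f(u)=\prod_{i=1}^n(u^2-\eta_i^2)$ in $B[u]$); $e_i$ is the $i$th elementary symmetric polynomial. Let $\tilde\Delta\in A$ be the discriminant of $\sum_{i=0}^na_{2n-2i}v^i$ (a polynomial in $v$). The reduced discriminant of $(f,\alpha)$ is $\bar\Delta=4^n\alpha\tilde\Delta\in A$; in $B$ it equals $4^n\eta_1\cdots\eta_n\prod_{i<j}(\eta_i^2-\eta_j^2)^2$. $V(\bar\Delta,\partial\bar\Delta)$ is the set of $x\in\operatorname{Spec}(A)$ such that the image of $\bar\Delta$ in the local ring $A_x$ lies in $\mathfrak m_x^2$, where $\mathfrak m_x$ is the maximal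 ideal of $A_x$. An element $h$ of a normal ring $R$ is squarefree if $v_{\mathfrak p}(h)\in\{0,1\}$ for all height one primes $\mathfrak p$ of $R$, $v_{\mathfrak p}$ being the associated valuation. A subset of $\operatorname{Spec}(A)$ has codimension $\ge c$ if all primes it contains have height $\ge c$. *)

(* Defs.v *)
From HB Require Import structures.
From mathcomp Require Import all_boot all_order all_algebra ring.
From mathcomp Require Import mpoly.
From mathcomp Require Import boolp classical_sets.

Set Implicit Arguments.
Unset Strict Implicit.
Unset Printing Implicit Defensive.

Import GRing.Theory.
Local Open Scope ring_scope.
Local Open Scope quotient_scope.
Local Open Scope classical_set_scope.

Section Ideals.
Variable R : comPzRingType.
Implicit Types (I J X : set R).

Definition is_unit (x : R) : Prop := exists y, x * y = 1.

Definition is_ideal I : Prop :=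
  [/\ I 0, forall x y, I x -> I y -> I (x + y)
         & forall a x, I x -> I (a * x)].

Definition ideal_gen X : set R := smallest is_ideal X.

Definition ideal_mul I J : set R :=
  ideal_gen [set z | exists x y, [/\ I x, J y & z = x * y]].

Definition noetherian : Prop :=
  forall I, is_ideal I -> exists s : seq R, I = ideal_gen [set` s].

Lemma ideal_gen_ideal X : is_ideal (ideal_gen X).
Proof.
split=> [I [[]]//|x y Ix Iy I II|a x Ix I II].
- by have [[_ ID _] _] := II; apply: ID; [apply: Ix|apply: Iy].
- by have [[_ _ IM] _] := II; apply: IM; apply: Ix.
Qed.

End Ideals.

(* The quotient of R by the ideal generated by X. It may be the zero ring, hence
   comPzRingType; MathComp's own ring quotients require a proper ideal. *)
Section QuotientRing.
Variables (R : comPzRingType) (X : set R).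

Definition ideal_pred : R -> bool := fun x => `[< ideal_gen X x >].

Lemma ideal_predP x : reflect (ideal_gen X x) (x \in ideal_pred).
Proof. exact: asboolP. Qed.

Lemma ideal_predM a x : x \in ideal_pred -> a * x \in ideal_pred.
Proof.
by have [_ _ IM] := ideal_gen_ideal X; move=> /ideal_predP/(IM a)/ideal_predP.
Qed.

Lemma ideal_pred_zmod : zmod_closed ideal_pred.
Proof.
have [I0 ID IM] := ideal_gen_ideal X; split; first exact/ideal_predP.
move=> x y /ideal_predP Ix /ideal_predP Iy; apply/ideal_predP.
by rewrite -mulN1r; apply: ID => //; apply: IM.
Qed.

HB.instance Definition _ := GRing.isZmodClosed.Build R ideal_pred ideal_pred_zmod.

Local Notation Q := {ideal_quot (GRing.ZmodClosed.clone R ideal_pred _)}.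

Definition quot_gen : Type := Q.

HB.instance Definition _ := GRing.Zmodule.on quot_gen.

Definition quot_pi (x : R) : quot_gen := \pi_Q x.
Let one : quot_gen := quot_pi 1.
Let mul (x y : quot_gen) : quot_gen :=
  quot_pi (repr (x : Q)
           * repr (y : Q)).

Let piE x y : x - y \in ideal_pred -> quot_pi x = quot_pi y.
Proof. by rewrite Quotient.idealrBE => /eqP. Qed.

Let repr_pi x : repr (quot_pi x : Q) - x \in ideal_pred.
Proof. by rewrite Quotient.idealrBE /quot_pi reprK. Qed.

Let pi_mul x y : mul (quot_pi x) (quot_pi y) = quot_pi (x * y).
Proof.
set x' := repr (quot_pi x : Q).
set y' := repr (quot_pi y : Q).
apply: piE; rewrite -/x' -/y'.
have -> : x' * y' - x * y = y' * (x' - x) + x * (y' - y).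
  by ring.
by apply: rpredD; apply: ideal_predM; apply: repr_pi.
Qed.

Let pi_surj (x : quot_gen) : exists y, x = quot_pi y.
Proof.
by exists (repr (x : Q)); rewrite /quot_pi reprK.
Qed.

Lemma quot_pi_zmod : zmod_morphism quot_pi.
Proof. by move=> x y; rewrite /quot_pi raddfB. Qed.

Let mulA : associative mul.
Proof.
move=> x y z; have [a ->] := pi_surj x; have [b ->] := pi_surj y.
by have [c ->] := pi_surj z; rewrite !pi_mul mulrA.
Qed.

Let mulC : commutative mul.
Proof.
move=> x y; have [a ->] := pi_surj x; have [b ->] := pi_surj y.
by rewrite !pi_mul mulrC.
Qed.

Let mul1 : left_id one mul.
Proof. by move=> x; have [a ->] := pi_surj x; rewrite pi_mul mul1r. Qed.

HB.instance Definition _ :=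
  GRing.isZmodMorphism.Build R quot_gen quot_pi quot_pi_zmod.

Let mulDl : left_distributive mul +%R.
Proof.
move=> x y z; have [a ->] := pi_surj x; have [b ->] := pi_surj y.
by have [c ->] := pi_surj z; rewrite -raddfD !pi_mul -raddfD mulrDl.
Qed.

HB.instance Definition _ :=
  GRing.Zmodule_isComPzRing.Build quot_gen mulA mulC mul1 mulDl.

Lemma quot_pi_monoid : monoid_morphism quot_pi.
Proof. by split=> // x y; rewrite -pi_mul. Qed.

HB.instance Definition _ :=
  GRing.isMonoidMorphism.Build R quot_gen quot_pi quot_pi_monoid.

End QuotientRing.

(* Multiplicative sets not containing 0, so that localizations are nonzero. *)
Record mulset (R : comPzRingType) := Mulset {
  mulset_set :> R -> Prop;
  mulset1 : mulset_set 1;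
  mulsetM : forall x y, mulset_set x -> mulset_set y -> mulset_set (x * y);
  mulset0 : ~ mulset_set 0 }.

Section Localization.
Variables (R : comPzRingType) (S : mulset R).

Definition denom := {s : R | `[< S s >]}.
Definition frac : Type := (R * denom)%type.
HB.instance Definition _ := Choice.on frac.

Let denomP (s : denom) : S (sval s).
Proof. by case: s => s /= /asboolP. Qed.
Let denom1 : denom := exist _ 1 (asboolT (mulset1 S)).
Let denomM (s t : denom) : denom :=
  exist _ (sval s * sval t) (asboolT (mulsetM (denomP s) (denomP t))).

Definition frac_eq (x y : frac) : bool :=
  `[< exists2 u, S u & u * (x.1 * sval y.2) = u * (y.1 * sval x.2) >].

Let frac_refl : reflexive frac_eq.
Proof. by move=> x; apply/asboolP; exists 1 => //; apply: mulset1. Qed.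

Let frac_sym : ssrbool.symmetric frac_eq.
Proof. by move=> x y; apply/asboolP/asboolP => -[u Su e]; exists u. Qed.

Let frac_trans : transitive frac_eq.
Proof.
move=> [b [t Pt]] [a [s Ps]] [c [r Pr]] /asboolP[u Su /= e1] /asboolP[v Sv /= e2].
apply/asboolP; exists (u * v * t) => /=.
  by apply: mulsetM; [apply: mulsetM|apply/asboolP].
transitivity (u * (a * t) * (v * r)); first by ring.
rewrite e1; transitivity (v * (b * r) * (u * s)); first by ring.
by rewrite e2; ring.
Qed.

Canonical frac_equiv := EquivRel frac_eq frac_refl frac_sym frac_trans.

Definition loc : Type := {eq_quot frac_eq}.
HB.instance Definition _ := EqQuotient.on loc.
HB.instance Definition _ := Choice.on loc.

Definition loc_frac (x : frac) : loc := \pi_loc x.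

Let fracE x y u : S u -> u * (x.1 * sval y.2) = u * (y.1 * sval x.2) ->
  loc_frac x = loc_frac y.
Proof. by move=> Su e; apply/eqmodP/asboolP; exists u. Qed.

Let frac_repr x : exists2 u, S u &
  u * ((repr (loc_frac x)).1 * sval x.2) =
  u * (x.1 * sval (repr (loc_frac x)).2).
Proof.
have /eqmodP/asboolP[u Su e] : repr (loc_frac x) = x %[mod loc].
  exact: reprK.
by exists u.
Qed.

Let loc_surj (x : loc) : exists y, x = loc_frac y.
Proof. by exists (repr x); rewrite /loc_frac reprK. Qed.

Let zero : loc := loc_frac (0, denom1).
Let one : loc := loc_frac (1, denom1).
Definition add_frac (x y : frac) : frac :=
  (x.1 * sval y.2 + y.1 * sval x.2, denomM x.2 y.2).
Definition opp_frac (x : frac) : frac := (- x.1, x.2).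
Definition mul_frac (x y : frac) : frac := (x.1 * y.1, denomM x.2 y.2).
Let add (x y : loc) : loc := loc_frac (add_frac (repr x) (repr y)).
Let opp (x : loc) : loc := loc_frac (opp_frac (repr x)).
Let mul (x y : loc) : loc := loc_frac (mul_frac (repr x) (repr y)).

Let addE x y : add (loc_frac x) (loc_frac y) = loc_frac (add_frac x y).
Proof.
have [u Su ex] := frac_repr x; have [v Sv ey] := frac_repr y.
rewrite /add; set x' := repr (loc_frac x) in ex *.
set y' := repr (loc_frac y) in ey *.
apply: (@fracE _ _ (u * v)); first exact: mulsetM.
rewrite /=; transitivity
  (u * (x'.1 * sval x.2) * (v * sval y'.2 * sval y.2)
   + v * (y'.1 * sval y.2) * (u * sval x'.2 * sval x.2)); first by ring.
by rewrite ex ey; ring.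
Qed.

Let oppE x : opp (loc_frac x) = loc_frac (opp_frac x).
Proof.
have [u Su ex] := frac_repr x.
by apply: (@fracE _ _ u) => //=; rewrite !mulNr !mulrN ex.
Qed.

Let mulE x y : mul (loc_frac x) (loc_frac y) = loc_frac (mul_frac x y).
Proof.
have [u Su ex] := frac_repr x; have [v Sv ey] := frac_repr y.
rewrite /mul; set x' := repr (loc_frac x) in ex *.
set y' := repr (loc_frac y) in ey *.
apply: (@fracE _ _ (u * v)); first exact: mulsetM.
rewrite /=; transitivity
  (u * (x'.1 * sval x.2) * (v * (y'.1 * sval y.2))); first by ring.
by rewrite ex ey; ring.
Qed.

Let fracE1 x y : x.1 * sval y.2 = y.1 * sval x.2 -> loc_frac x = loc_frac y.
Proof. by move=> e; apply: (fracE (mulset1 S)); rewrite e. Qed.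

Let addA : associative add.
Proof.
move=> x y z; have [a ->] := loc_surj x; have [b ->] := loc_surj y.
by have [c ->] := loc_surj z; rewrite !addE; apply: fracE1 => /=; ring.
Qed.

Let addC : commutative add.
Proof.
move=> x y; have [a ->] := loc_surj x; have [b ->] := loc_surj y.
by rewrite !addE; apply: fracE1 => /=; ring.
Qed.

Let add0 : left_id zero add.
Proof.
by move=> x; have [a ->] := loc_surj x; rewrite addE; apply: fracE1 => /=; ring.
Qed.

Let addN : left_inverse zero opp add.
Proof.
move=> x; have [a ->] := loc_surj x.
by rewrite oppE addE; apply: fracE1 => /=; ring.
Qed.

HB.instance Definition _ := GRing.isZmodule.Build loc addA addC add0 addN.

Let mulA : associative mul.
Proof.
move=> x y z; have [a ->] := loc_surj x; have [b ->] := loc_surj y.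
by have [c ->] := loc_surj z; rewrite !mulE; apply: fracE1 => /=; ring.
Qed.

Let mulC : commutative mul.
Proof.
move=> x y; have [a ->] := loc_surj x; have [b ->] := loc_surj y.
by rewrite !mulE; apply: fracE1 => /=; ring.
Qed.

Let mul1 : left_id one mul.
Proof.
by move=> x; have [a ->] := loc_surj x; rewrite mulE; apply: fracE1 => /=; ring.
Qed.

Let mulDl : left_distributive mul add.
Proof.
move=> x y z; have [a ->] := loc_surj x; have [b ->] := loc_surj y.
have [c ->] := loc_surj z.
by rewrite addE !mulE addE; apply: fracE1 => /=; ring.
Qed.

Let one_neq0 : one != zero.
Proof.
apply/eqP => /eqmodP/asboolP[u Su /=]; rewrite !mulr1 mulr0 => u0.
by apply: (@mulset0 _ S); rewrite -u0.
Qed.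

HB.instance Definition _ :=
  GRing.Zmodule_isComNzRing.Build loc mulA mulC mul1 mulDl one_neq0.

Definition loc_map (x : R) : loc := loc_frac (x, denom1).

Lemma loc_map_zmod : zmod_morphism loc_map.
Proof.
move=> x y; rewrite [RHS](_ : _ = add (loc_map x) (opp (loc_map y))) //.
by rewrite oppE addE; apply: fracE1 => /=; ring.
Qed.

Lemma loc_map_monoid : monoid_morphism loc_map.
Proof.
split=> // x y; rewrite [RHS](_ : _ = mul (loc_map x) (loc_map y)) //.
by rewrite mulE; apply: fracE1 => /=; ring.
Qed.

HB.instance Definition _ :=
  GRing.isZmodMorphism.Build R loc loc_map loc_map_zmod.
HB.instance Definition _ :=
  GRing.isMonoidMorphism.Build R loc loc_map loc_map_monoid.

End Localization.

Record Spec (R : comPzRingType) := MkSpec {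
  prime_set :> R -> Prop;
  prime_ideal : is_ideal prime_set;
  prime_proper : ~ prime_set 1;
  primeM : forall x y, prime_set (x * y) -> prime_set x \/ prime_set y }.

Section LocalRings.
Variables (R : comPzRingType) (p : Spec R).

Fact prime_compl1 : (~` p) 1. Proof. exact: prime_proper. Qed.
Fact prime_complM x y : (~` p) x -> (~` p) y -> (~` p) (x * y).
Proof. by move=> px py /primeM[]. Qed.
Fact prime_compl0 : ~ (~` p) 0.
Proof. by case: (prime_ideal p) => p0 _ _; apply. Qed.

Definition prime_compl : mulset R :=
  Mulset prime_compl1 prime_complM prime_compl0.

Definition local_ring : comNzRingType := loc prime_compl.

Definition to_local : {rmorphism R -> local_ring} := @loc_map R prime_compl.

Definition max_ideal : set local_ring := ideal_gen (to_local @` p).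

(* height p >= c *)
Definition height_ge (c : nat) : Prop :=
  exists q : nat -> Spec R,
    (q c = p :> set R) /\ forall i, (i < c)%N -> q i `<` q i.+1.

(* v_p(h) = k, where v_p is the valuation of the discrete valuation ring R_p:
   h is a unit times the k-th power of a uniformizer. *)
Definition has_valuation (h : R) (k : nat) : Prop :=
  exists t u : local_ring,
    [/\ ideal_gen [set t] = max_ideal, is_unit u & to_local h = u * t ^+ k].

End LocalRings.

Arguments to_local {R} p.
Arguments max_ideal {R} p.

Definition codim_ge (R : comPzRingType) (Z : set (Spec R)) (c : nat) : Prop :=
  forall p, Z p -> height_ge p c.

Definition squarefree (R : comPzRingType) (h : R) : Prop :=
  forall p : Spec R, height_ge p 1 -> ~ height_ge p 2 ->
    has_valuation p h 0 \/ has_valuation p h 1.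

Section Normal.

Section TotalFractions.
Variable D : comNzRingType.

Fact regular1 : GRing.lreg (1 : D). Proof. exact: lreg1. Qed.
Fact regularM (x y : D) : GRing.lreg x -> GRing.lreg y -> GRing.lreg (x * y).
Proof. exact: lregM. Qed.
Fact regular0 : ~ GRing.lreg (0 : D).
Proof. by move=> /lreg_neq0/eqP. Qed.

Definition regulars : mulset D := @Mulset D [set x | GRing.lreg x]
  regular1 regularM regular0.

Definition is_domain : Prop := forall x y : D, x * y = 0 -> x = 0 \/ y = 0.

(* For a domain D, loc regulars is its field of fractions. *)
Definition integrally_closed : Prop :=
  forall z : loc regulars, integralOver (@loc_map D regulars) z ->
    exists x, z = loc_map regulars x.

End TotalFractions.

Definition normal_ring (R : comPzRingType) : Prop :=
  forall p : Spec R,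
    is_domain (local_ring p) /\ integrally_closed (local_ring p).

End Normal.

(* V(h, dh) *)
Definition sing_locus (R : comPzRingType) (h : R) : set (Spec R) :=
  [set x | ideal_mul (max_ideal x) (max_ideal x) (to_local x h)].

(* Discriminant of a monic polynomial. MathComp's resultant p q lists the
   coefficients of the Sylvester rows in increasing order, so resultant g^`() g
   is the usual Res(g, g'), i.e. the product of the g'(r), r the roots of g;
   as g is monic this does not depend on the actual degree of g'. *)
Definition discriminant (A : comNzRingType) (g : {poly A}) : A :=
  (-1) ^+ 'C((size g).-1, 2) * resultant g^`() g.

Section TypeD.
Variables (A : comNzRingType) (n : nat) (f : {poly A}) (alpha : A).

(* a_k is the coefficient of u^(2n - k) in f. *)
Definition dcoef (k : nat) : A := f`_(2 * n - k).

Definition dsplit_gens : set {mpoly A[n]} :=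
  [set g | (exists2 i : nat, (1 <= i <= n.-1)%N &
              g = (dcoef (2 * i))%:MP
                  - (-1) ^+ i * (mesym n A i \mPo [tuple 'X_j ^+ 2 | j < n]))
           \/ g = \prod_(j < n) 'X_j - alpha%:MP].

Definition DSplit : comPzRingType := quot_gen dsplit_gens.

Definition tilde_disc : A :=
  discriminant (\sum_(i < n.+1) dcoef (2 * n - 2 * i) *: 'X^i).

Definition reduced_disc : A := 4 ^+ n * alpha * tilde_disc.

End TypeD.

(* Main.v *)
(** Fix a prime [p] of [A] and embed [A_p] into a field [E] in which [f] splits as
    [prod ('X^2 - eta_i^2)] with [prod eta_i = alpha]. An element [z] of [B], represented by
    a polynomial in [x_1, ..., x_n], gives the function [w |-> z (w eta)] on the group [W] of
    even signed permutations. Let [V = prod_(i < j) (x_j^2 - x_i^2)], so that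
    [V(eta)^2] is the discriminant up to sign. An explicit kernel [D(x, y)] that vanishes at
    [y = w x] for [w <> 1] in [W] and equals [V] up to a unit at [y = x] yields, on writing
    [D = sum_b b(x) b'(y)], the identity [z = sum_b b p_b] where [V p_b] is, up to a unit, the
    antisymmetrization of [z b']. The [p_b] are [W]-invariant, hence reduce to constants of
    [A] in [B].

    If [z / r] is integral over [A_p], then so is [V(eta) k] for [k = p_b / r], whence [k^2]
    times the discriminant lies in [A_p]. At a pole of [k], which by normality can be taken
    of height one and locally principal, the discriminant would have valuation at least [2];
    so [k] is in [A_p], and [z / r] is in [B] localized at [p]. In particular the
    idempotents of the total ring of fractions are in this localization, and its local
    rings are integrally closed domains. *)

Require Import Defs.
From HB Require Import structures.
From mathcomp Require Import all_boot all_order all_algebra.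
From mathcomp Require Import fieldext perm.
From mathcomp Require Import ring.
From mathcomp Require Import mpoly.
From mathcomp Require Import boolp classical_sets.

Set Implicit Arguments.
Unset Strict Implicit.
Unset Printing Implicit Defensive.

Import GRing.Theory.
Local Open Scope ring_scope.
Local Open Scope classical_set_scope.

(** * Ideals and localizations *)

Section Ideals.
Variable R : comPzRingType.
Implicit Types (I J X : set R).

Lemma sub_ideal_gen X : X `<=` ideal_gen X.
Proof. by move=> x Xx I [_]; apply. Qed.

Lemma ideal_gen_min X I : is_ideal I -> X `<=` I -> ideal_gen X `<=` I.
Proof. by move=> II XI x; apply. Qed.

Lemma ideal_sum I (T : Type) (s : seq T) (P : pred T) (F : T -> R) : is_ideal I ->
  (forall i, P i -> I (F i)) -> I (\sum_(i <- s | P i) F i).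
Proof. by move=> [I0 ID _] IF; apply: big_ind. Qed.

Lemma ideal_opp I x : is_ideal I -> I x -> I (- x).
Proof. by move=> [_ _ IM] Ix; rewrite -mulN1r; apply: IM. Qed.

Lemma ideal_sub I x y : is_ideal I -> I x -> I y -> I (x - y).
Proof. by move=> II Ix Iy; have [_ ID _] := II; apply: ID => //; exact: ideal_opp. Qed.

Lemma ideal_gen_seqP (s : seq R) x : ideal_gen [set` s] x ->
  exists c : 'I_(size s) -> R, x = \sum_i c i * s`_i.
Proof.
move: x; apply: ideal_gen_min => [|x xs].
  split=> [|x y [c ->] [d ->]|a x [c ->]].
  - by exists (fun=> 0); rewrite big1// => i _; rewrite mul0r.
  - exists (fun i => c i + d i); rewrite -big_split/=.
    by apply: eq_bigr => i _; rewrite mulrDl.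
  - exists (fun i => a * c i); rewrite mulr_sumr.
    by apply: eq_bigr => i _; rewrite mulrA.
have lt : (index x s < size s)%N by rewrite index_mem.
exists (fun i => (i == Ordinal lt)%:R); rewrite (bigD1 (Ordinal lt))//= eqxx mul1r.
rewrite nth_index ?big1 ?addr0//.
by move=> i /negPf->; rewrite mul0r.
Qed.

Lemma ideal_gen1P (t x : R) : ideal_gen [set t] x <-> exists c, x = c * t.
Proof.
split=> [|[c ->]]; last first.
  by have [_ _] := ideal_gen_ideal [set t]; apply; apply: sub_ideal_gen.
move: x; apply: ideal_gen_min => [|x ->]; last by exists 1; rewrite mul1r.
split=> [|x y [c ->] [d ->]|a x [c ->]].
- by exists 0; rewrite mul0r.
- by exists (c + d); rewrite mulrDl.
- by exists (a * c); rewrite mulrA.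
Qed.

Lemma noetherian_chain (I : nat -> set R) : noetherian R ->
  (forall k, is_ideal (I k)) -> (forall k, I k `<=` I k.+1) ->
  exists k, I k.+1 `<=` I k.
Proof.
move=> hN II Imono.
have Ile k l : (k <= l)%N -> I k `<=` I l.
  move=> /subnK <-; elim: (l - k)%N => [//|d IH].
  by apply: subset_trans IH _; rewrite addSn; apply: Imono.
have UI : is_ideal [set x | exists k, I k x].
  split=> [|x y [k Ix] [l Iy]|a x [k Ix]].
  - by exists 0%N; case: (II 0%N).
  - exists (maxn k l); have [_ ID _] := II (maxn k l).
    by apply: ID; [apply: Ile Ix; rewrite leq_maxl|apply: Ile Iy; rewrite leq_maxr].
  - by exists k; have [_ _] := II k; apply.
have [s Us] := hN _ UI.
have [k Ik] : exists k, [set` s] `<=` I k.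
  have : [set` s] `<=` [set x | exists k, I k x] by rewrite Us; apply: sub_ideal_gen.
  elim: s {Us} => [|x s IH] sU; first by exists 0%N.
  have [l Il] : exists l, [set` s] `<=` I l.
    by apply: IH => y ys; apply: sU; rewrite /= inE ys orbT.
  have [m Im] : [set x | exists k, I k x] x by apply: sU; rewrite /= inE eqxx.
  exists (maxn m l) => y; rewrite /= inE => /orP[/eqP->|ys].
    by apply: Ile Im; rewrite leq_maxl.
  by apply: Ile (Il _ ys); rewrite leq_maxr.
exists k => x Ix; apply: (ideal_gen_min (II k) Ik).
by rewrite -Us; exists k.+1.
Qed.

Lemma noetherian_max (T : Type) (F : T -> set R) (t0 : T) : noetherian R ->
  (forall t, is_ideal (F t)) ->
  exists t, forall u, F t `<=` F u -> F u `<=` F t.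
Proof.
move=> hN FI; apply: contrapT => noM.
have /choice[g gP] : forall t, exists u, F t `<=` F u /\ ~ (F u `<=` F t).
  move=> t; apply: contrapT => nu; apply: noM; exists t => u tu.
  by apply: contrapT => nut; apply: nu; exists u.
have [k] := @noetherian_chain (fun k => F (iter k g t0)) hN (fun=> FI _)
  (fun k => (gP (iter k g t0)).1).
by case: (gP (iter k g t0)).
Qed.

End Ideals.

Section LocalizationTheory.
Variables (R : comPzRingType) (S : mulset R).

Lemma loc_map_eq x y :
  loc_map S x = loc_map S y <-> exists2 u, S u & u * x = u * y.
Proof.
split=> [/eqmodP/asboolP[u Su /=]|[u Su e]].
  by rewrite !mulr1; exists u.
by apply/eqmodP/asboolP; exists u => //=; rewrite !mulr1.
Qed.

Lemma loc_map_eq0 x : loc_map S x = 0 <-> exists2 u, S u & u * x = 0.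
Proof.
rewrite -(rmorph0 (loc_map S)) loc_map_eq.
by split=> -[u Su e]; exists u => //; rewrite e mulr0.
Qed.

Lemma loc_fracK x (s : denom S) : loc_frac (x, s) * loc_map S (sval s) = loc_map S x.
Proof.
pose d1 : denom S := exist _ 1 (asboolT (mulset1 S)).
have repE (y : Defs.frac S) : exists2 u : R, S u &
    u * ((repr (loc_frac y)).1 * sval y.2) = u * (y.1 * sval (repr (loc_frac y)).2).
  have /eqmodP/asboolP[u Su e] : (repr (loc_frac y) = y %[mod loc S])%qT.
    exact: reprK.
  by exists u.
have [u Su /= eu] := repE (x, s); have [v Sv /= ev] := repE (sval s, d1).
apply/eqmodP/asboolP; exists (u * v); first exact: mulsetM.
rewrite /= -/(loc_frac (x, s)) -/(loc_frac (sval s, d1)).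
set a := repr _ in eu *; set b := repr _ in ev *.
rewrite mulr1 in ev *.
have Ss : S (sval s) by case: (s) => ? /= /asboolP.
transitivity (u * a.1 * (v * b.1)); first by ring.
rewrite ev; transitivity (u * (a.1 * sval s) * v * sval b.2); first by ring.
by rewrite eu; ring.
Qed.

Lemma loc_surj (z : loc S) : exists x s, S s /\ z * loc_map S s = loc_map S x.
Proof.
have -> : z = loc_frac (repr z) by rewrite /loc_frac reprK.
case: (repr z) => x s; exists x, (sval s).
by split; [case: (s) => ? /= /asboolP|exact: loc_fracK].
Qed.

Lemma loc_map_unit s : S s -> is_unit (loc_map S s).
Proof.
move=> Ss; pose d : denom S := exist _ s (asboolT Ss).
exists (loc_frac (1, d)); rewrite mulrC.
have -> : s = sval d by [].
by rewrite loc_fracK rmorph1.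
Qed.

Lemma noetherian_loc : noetherian R -> noetherian (loc S).
Proof.
move=> hN I II; have [I0 ID IM] := II.
have [|s sE] := hN [set x | I (loc_map S x)].
  split=> [|x y Ix Iy|a x Ix] /=; first by rewrite rmorph0.
    by rewrite rmorphD; apply: ID.
  by rewrite rmorphM; apply: IM.
exists [seq loc_map S x | x <- s]; rewrite eqEsubset; split=> z; last first.
  apply: (ideal_gen_min II) => _ /= /mapP[x xs ->].
  have : ideal_gen [set` s] x by apply: sub_ideal_gen.
  by rewrite -sE.
move=> Iz; have [x [t [St e]]] := loc_surj z.
have : [set x | I (loc_map S x)] x by rewrite /= -e mulrC; apply: IM.
rewrite sE => Ix; have [t' tt'] := loc_map_unit St.
have -> : z = t' * loc_map S x by rewrite -e mulrCA [t' * _]mulrC tt' mulr1.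
have [G0 GD GM] := ideal_gen_ideal [set` [seq loc_map S x | x <- s]].
apply: (GM); move: x Ix {e}; apply: ideal_gen_min.
  split=> [|x y Ix Iy|a x Ix] /=; first by rewrite rmorph0.
    by rewrite rmorphD; apply: GD.
  by rewrite rmorphM; apply: GM.
by move=> x xs /=; apply: sub_ideal_gen; apply/mapP; exists x.
Qed.

End LocalizationTheory.

(** * Noetherian normal domains *)

Lemma domain_lreg (D : comNzRingType) (a : D) : is_domain D -> a != 0 -> GRing.lreg a.
Proof.
move=> dD a0 x y e; apply/eqP; rewrite -subr_eq0; apply/eqP.
have /dD[az|//] : a * (x - y) = 0 by rewrite mulrBr e subrr.
by rewrite az eqxx in a0.
Qed.

Lemma loc_regulars_inj (D : comNzRingType) : injective (@loc_map D (regulars D)).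
Proof. by move=> x y /loc_map_eq[u ru /ru]. Qed.

Section FractionField.
Variables (D : comNzRingType) (dD : is_domain D).

(** The [let] makes the type depend on [dD], so that a field structure can be attached to it. *)
Definition fracfield : Type := let _ := dD in loc (regulars D).
HB.instance Definition _ := GRing.ComNzRing.on fracfield.

Definition frac_inv (x : fracfield) : fracfield :=
  if pselect (exists y, y * x = 1) is left h then sval (cid h) else 0.

Fact frac_mulVf x : x != 0 -> frac_inv x * x = 1.
Proof.
move=> x0; rewrite /frac_inv; case: pselect => [h|[]]; first by case: cid.
have [a [s [rs e]]] := @loc_surj D (regulars D) x.
have a0 : a != 0.
  apply: contraNneq x0 => a0; rewrite a0 rmorph0 in e.
  have [y sy] := loc_map_unit rs.
  have -> : x = x * loc_map (regulars D) s * y by rewrite -mulrA sy mulr1.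
  by rewrite e mul0r.
have [y ay] : is_unit (loc_map (regulars D) a).
  by apply: loc_map_unit; apply: domain_lreg.
by exists (loc_map (regulars D) s * y); rewrite mulrAC [_ * x]mulrC e.
Qed.

Fact frac_inv0 : frac_inv 0 = 0.
Proof.
rewrite /frac_inv; case: pselect => // h; have [y] := h.
by rewrite mulr0 => /esym/eqP; rewrite oner_eq0.
Qed.

HB.instance Definition _ :=
  GRing.ComNzRing_isField.Build fracfield frac_mulVf frac_inv0.

Definition to_frac : {rmorphism D -> fracfield} := @loc_map D (regulars D).

Lemma to_frac_inj : injective to_frac.
Proof. exact: loc_regulars_inj. Qed.

End FractionField.

(** The homogenization of [p], which is [b ^ deg p * p(a / b)] wherever the fraction makes sense. *)
Definition hom_eval (D : nzRingType) (p : {poly D}) (a b : D) : D :=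
  \sum_(i < size p) p`_i * (a ^+ i * b ^+ ((size p).-1 - i)).

Lemma hom_evalE (D S : comNzRingType) (f : {rmorphism D -> S}) (p : {poly D})
    (a b : D) (z : S) : z * f b = f a ->
  f (hom_eval p a b) = f b ^+ (size p).-1 * (map_poly f p).[z].
Proof.
move=> e; rewrite rmorph_sum/= /map_poly horner_poly mulr_sumr; apply: eq_bigr => i _.
have le_i : (i <= (size p).-1)%N by rewrite -ltnS (leq_trans (ltn_ord i)) ?leqSpred.
rewrite !rmorphM !rmorphXn -e exprMn -mulrA -exprD subnKC//.
by rewrite [RHS]mulrCA [f b ^+ _ * _]mulrC.
Qed.

(** An integral equation of [a / b], multiplied by a power of [b], becomes an identity in [D]; it
    then holds in the total ring of fractions too, where [integrally_closed] applies. *)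
Lemma integrally_closed_frac (D F : comNzRingType) (g : {rmorphism D -> F}) (a b : D)
    (z : F) : integrally_closed D -> injective g -> GRing.lreg b ->
  z * g b = g a -> integralOver g z -> exists c, a = c * b.
Proof.
move=> ic ginj rb zba [p pm /rootP pz].
have h0 : hom_eval p a b = 0.
  by apply: ginj; rewrite (hom_evalE _ zba) pz mulr0 rmorph0.
have [y by1] := @loc_map_unit D (regulars D) b rb.
pose l : {rmorphism D -> loc (regulars D)} := @loc_map D (regulars D).
have e : l a * y * l b = l a by rewrite -mulrA [y * _]mulrC by1 mulr1.
have [|c ce] := ic (l a * y).
  exists p => //; apply/rootP; have := hom_evalE p e.
  rewrite h0 rmorph0 => /esym/(congr1 (fun t => y ^+ (size p).-1 * t)).
  by rewrite mulr0 mulrA -exprMn [y * _]mulrC by1 expr1n mul1r.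
exists c; apply: (@loc_regulars_inj D).
by rewrite -[LHS]e ce rmorphM.
Qed.

(* An ideal stable under [k] is a finitely generated faithful module on which [k]
   acts with a matrix over [D], whose characteristic polynomial kills [k]. *)
Lemma integral_stable_ideal (D : comNzRingType) (F : fieldType)
    (g : {rmorphism D -> F}) (q : set D) (k : F) (y0 : D) :
    noetherian D -> is_ideal q -> q y0 -> g y0 != 0 ->
    (forall y, q y -> exists2 y', q y' & k * g y = g y') ->
  integralOver g k.
Proof.
move=> hN qI qy0 gy0 qk; have [s sE] := hN _ qI.
have qs (i : 'I_(size s)) : q s`_i.
  by rewrite sE; apply: sub_ideal_gen; rewrite /= mem_nth.
have /choice[M ME] : forall i : 'I_(size s), exists c : 'I_(size s) -> D,
    k * g s`_i = g (\sum_j c j * s`_j).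
  move=> i; have [y' qy' ->] := qk _ (qs i).
  by rewrite sE in qy'; have [c ->] := ideal_gen_seqP qy'; exists c.
pose A := \matrix_(i, j) M j i.
exists (char_poly A); first exact: char_poly_monic.
rewrite map_char_poly -eigenvalue_root_char; apply/eigenvalueP.
exists (\row_i g s`_i).
  apply/rowP => j; rewrite !mxE ME rmorph_sum; apply: eq_bigr => i _.
  by rewrite !mxE rmorphM mulrC.
apply: contraNneq gy0 => v0; rewrite sE in qy0.
have [c ->] := ideal_gen_seqP qy0.
rewrite rmorph_sum big1// => i _; rewrite rmorphM.
by have /rowP/(_ i) := v0; rewrite !mxE => ->; rewrite mulr0.
Qed.

(* Some multiple of a fraction [a / b] outside of a noetherian normal domain [D] has a
   prime denominator ideal [q]; [q] is locally principal, with generator [t]. *)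
Lemma prime_denominator (D : comNzRingType) (a b : D) :
    noetherian D -> is_domain D -> integrally_closed D -> b != 0 ->
    ~ (exists c, a = c * b) ->
  exists q : Spec D, exists c t s : D,
    [/\ q b, q t, ~ q s, t * (c * a) = s * b & forall y, q y -> exists z, s * y = z * t].
Proof.
move=> hN dD ic b0 nab.
(* [F c] is the denominator ideal of [c a / b], for the multiples of [a / b] not in [D]. A maximal
   one is prime. *)
pose T := {c : D | ~ exists d, c * a = d * b}.
have t1 : ~ exists d, 1 * a = d * b by rewrite mul1r.
pose F (c : T) := [set x | exists d, x * (sval c * a) = d * b].
have FI c : is_ideal (F c).
  split=> [|x y [d ed] [e ee]|x y [d ed]].
  - by exists 0; rewrite !mul0r.
  - by exists (d + e); rewrite !mulrDl ed ee.
  - by exists (x * d); rewrite -!mulrA ed.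
have [[c nc] cmax] := noetherian_max (exist _ 1 t1 : T) hN FI.
set q := F _ in cmax.
have q1 : ~ q 1 by move=> [d]; rewrite mul1r => e; apply: (nc); exists d.
have qM x y : q (x * y) -> q x \/ q y.
  move=> [d ed]; have [|nqy] := pselect (q y); [by right|left].
  have nyc : ~ exists d, y * c * a = d * b.
    by move=> [e ee]; apply: nqy; exists e; rewrite -ee /= mulrA.
  (* The denominator ideal of [y c a / b] contains that of [c a / b], so by maximality the two
     agree. *)
  apply: (cmax (exist _ (y * c) nyc)).
    by move=> z [e /= ee]; exists (y * e); rewrite -mulrA -ee /=; ring.
  by exists d; rewrite /= -ed /=; ring.
pose Q := MkSpec (FI _) q1 qM.
have qb : q b by exists (c * a); rewrite mulrC.
(* Put [k = c a / b]. Either [k] maps some [t] of [q] to an [s] outside [q], and then [t] generates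
   [q] locally, or [k q] lies in [q] and [k] is integral. *)
have [ts|nts] := pselect (exists t s, [/\ q t, ~ q s & t * (c * a) = s * b]).
  have [t [s [qt nqs e]]] := ts; exists Q, c, t, s; split=> // y [z ez]; exists z.
  apply: (domain_lreg dD b0); rewrite mulrCA mulrA -e -mulrA [_ * y]mulrC ez; ring.
exfalso; apply: (nc); pose K := fracfield dD; pose g := to_frac dD.
have gb0 : g b != 0 by rewrite -(rmorph0 g) (inj_eq (@to_frac_inj _ _)).
apply: (integrally_closed_frac ic (@to_frac_inj _ dD) (domain_lreg dD b0)
  (divfK gb0 (g (c * a)))).
apply: (integral_stable_ideal hN (FI _) qb gb0) => y qy.
have [d ed] := qy; exists d.
  by apply: contrapT => nqd; apply: nts; exists y, d.
by rewrite mulrAC -rmorphM [c * a * y]mulrC ed rmorphM mulfK.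
Qed.

(** * Local rings, locally principal primes and poles *)

Section LocalRing.
Variables (A : comPzRingType) (p : Spec A).
Local Notation l := (to_local p).

Lemma to_local_unit s : ~ p s -> is_unit (l s).
Proof. exact: (@loc_map_unit A (prime_compl p)). Qed.

Lemma to_local_eq x y : l x = l y <-> exists2 u, ~ p u & u * x = u * y.
Proof. exact: (@loc_map_eq A (prime_compl p)). Qed.

Lemma to_local_eq0 x : l x = 0 <-> exists2 u, ~ p u & u * x = 0.
Proof. exact: (@loc_map_eq0 A (prime_compl p)). Qed.

Lemma to_local_surj z : exists x s, ~ p s /\ z * l s = l x.
Proof. exact: (@loc_surj A (prime_compl p)). Qed.

Lemma prime_mul x y : ~ p x -> ~ p y -> ~ p (x * y).
Proof. by move=> nx ny /primeM[]. Qed.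

Lemma primeMl x y : p y -> p (x * y).
Proof. by have [_ _] := prime_ideal p; apply. Qed.

Lemma primeMr x y : p x -> p (x * y).
Proof. by rewrite mulrC; apply: primeMl. Qed.

Lemma to_local_nunit x : p x -> ~ is_unit (l x).
Proof.
move=> px [z]; have [c [u [nu e]]] := to_local_surj z.
move=> xz; have /to_local_eq[v nv ev] : l (x * c) = l u.
  by rewrite rmorphM -e mulrA xz mul1r.
have : p (v * u) by rewrite -ev; apply/primeMl/primeMr.
exact: prime_mul.
Qed.

Lemma max_ideal_mem x : p x -> max_ideal p (l x).
Proof. by move=> px; apply: sub_ideal_gen; exists x. Qed.

Lemma unit_cancel (D : comPzRingType) (u x y : D) : is_unit u -> u * x = u * y -> x = y.
Proof. by move=> [v uv] e; rewrite -[x]mul1r -[y]mul1r -uv [u * v]mulrC -!mulrA e. Qed.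

Lemma sing_locusP (w x z t h : A) : ~ p w -> p x -> p t -> w * h = z * (x * t) ->
  sing_locus h p.
Proof.
move=> nw px pt e; have [v wv] := to_local_unit nw; rewrite /sing_locus /=.
have -> : l h = (l z * v) * (l x * l t).
  apply: (unit_cancel (to_local_unit nw)).
  by rewrite -[LHS]rmorphM e !rmorphM -[LHS]mul1r -wv; ring.
have [_ _] := ideal_gen_ideal [set z | exists x y, [/\ max_ideal p x, max_ideal p y & z = x * y]].
apply; apply: sub_ideal_gen; exists (l x), (l t).
by split=> //; apply: max_ideal_mem.
Qed.

(* Krull's principal ideal theorem, for locally principal primes. *)
Lemma locally_principal_height (t : A) : noetherian A -> p t ->
    (forall y, p y -> exists w z, ~ p w /\ w * y = z * t) ->
  ~ height_ge p 2.
Proof.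
move=> hN pt tgen [q [qp qlt]].
have [[q01 nq10] [q12 nq21]] := (qlt 0%N isT, qlt 1%N isT).
rewrite qp in q12 nq21.
have q1t : ~ q 1%N t.
  move=> qt; apply: nq21 => y /tgen[w [z [nw e]]].
  have : q 1%N (w * y) by rewrite e; case: (prime_ideal (q 1%N)) => _ _; apply.
  by move=> /primeM[/q12|].
(* Among the [x] in [q 1] outside [q 0], take one with [F x], its multiples in [A_p] contracted to
   [A], as large as possible. Writing [w x = z t] gives another candidate [z], which by maximality
   is itself a multiple of [x] in [A_p]. *)
pose T := {x | q 1%N x /\ ~ q 0%N x}.
have [x0 Tx0] : exists x, q 1%N x /\ ~ q 0%N x.
  apply: contrapT => nx; apply: nq10 => x q1x.
  by apply: contrapT => nq0x; apply: nx; exists x.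
pose F (x : T) := [set y | exists w c, ~ p w /\ w * y = c * sval x].
have FI x : is_ideal (F x).
  split=> [|y y' [w [c [nw e]]] [w' [c' [nw' e']]]|a y [w [c [nw e]]]].
  - by exists 1, 0; split; [exact: prime_proper|rewrite mulr0 mul0r].
  - exists (w * w'), (w' * c + w * c'); split; first exact: prime_mul.
    by rewrite mulrDr mulrDl -!mulrA -e -e'; ring.
  - by exists w, (a * c); split=> //; rewrite -mulrA -e; ring.
have [[x [q1x nq0x]] xmax] := noetherian_max (exist _ x0 Tx0 : T) hN FI.
have [w [z [nw e]]] := tgen _ (q12 _ q1x).
have q0M a b : q 0%N a -> q 0%N (a * b).
  by rewrite mulrC; case: (prime_ideal (q 0%N)) => _ _; apply.
have nq0w u : ~ p u -> ~ q 0%N u by move=> nu /q01/q12.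
have nq0z : ~ q 0%N z.
  move=> q0z; have : q 0%N (w * x) by rewrite e; apply: q0M.
  by move=> /primeM[/(nq0w _ nw)|].
have q1z : q 1%N z.
  have : q 1%N (z * t) by rewrite -e; case: (prime_ideal (q 1%N)) => _ _; apply.
  by case/primeM.
have [||w' [c [nw' e']]] := xmax (exist _ z (conj q1z nq0z)) _ z.
- move=> y [u [d [nu ey]]]; exists (u * w), (d * t); split; first exact: prime_mul.
  by rewrite mulrAC ey /= mulrAC -mulrA e; ring.
- by exists 1, 1; split; first exact: prime_proper.
(* From [w x = z t] and [w' z = c x], the element [w w' - c t] kills [z], so it lies in [q 0]; as
   [t] is in [p], so is [w w']. *)
have : q 0%N ((w * w' - c * t) * z).
  have -> : (w * w' - c * t) * z = 0.
    by rewrite mulrBl -mulrA e' /= -[c * t * z]mulrA [t * z]mulrC -e; ring.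
  by case: (prime_ideal (q 0%N)).
move=> /primeM[|//]; apply: nq0w => pwc; apply: (prime_mul nw nw').
have [_ pD _] := prime_ideal p; rewrite -[w * w'](subrK (c * t)).
by apply: (pD) => //; apply: primeMl.
Qed.

(* [q] is a height one prime at which the fraction [a / b] is not defined. *)
Lemma pole_prime (a b : local_ring p) :
    noetherian A -> is_domain (local_ring p) -> integrally_closed (local_ring p) ->
    b != 0 -> ~ (exists c, a = c * b) ->
  exists q : Spec A, exists (c : local_ring p) (t s : A),
    [/\ q `<=` p, forall x d, l x = d * b -> q x, q t /\ ~ q s,
        l t * (c * a) = l s * b
      & forall y, q y -> exists w z, ~ q w /\ w * y = z * t].
Proof.
move=> hN dD ic b0 nab.
have hND : noetherian (local_ring p) by apply: noetherian_loc.
have [Q [c [t [s [Qb Qt nQs e tgen]]]]] := prime_denominator hND dD ic b0 nab.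
have QU u : is_unit u -> ~ Q u.
  move=> [v uv] Qu; apply: (@prime_proper _ Q); rewrite -uv mulrC.
  by have [_ _] := prime_ideal Q; apply.
have QM x y : Q y -> Q (x * y) by have [_ _] := prime_ideal Q; apply.
have qI : is_ideal [set x | Q (l x)].
  have [Q0 QD _] := prime_ideal Q; split=> [|x y Qx Qy|x y Qx] /=.
  - by rewrite rmorph0.
  - by rewrite rmorphD; apply: (QD).
  - by rewrite rmorphM; apply: (QM).
have q1 : ~ Q (l 1) by rewrite rmorph1; apply: prime_proper.
have qM x y : Q (l (x * y)) -> Q (l x) \/ Q (l y) by rewrite rmorphM => /primeM.
pose q := MkSpec qI q1 qM.
have qp : q `<=` p.
  by move=> x qx; apply: contrapT => npx; apply: (QU) qx; apply: to_local_unit.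
have [t' [u [nu et]]] := to_local_surj t.
have [s' [v [nv es]]] := to_local_surj s.
have nQl x : ~ p x -> ~ Q (l x) by move=> nx; apply/QU/to_local_unit.
have lM x y : ~ Q x -> ~ Q y -> ~ Q (x * y) by move=> nx ny /primeM[].
exists q, c, (v * t'), (s' * u); split=> //.
- by move=> x d xd; rewrite /q /= xd; apply: (QM).
- split; rewrite /q /= rmorphM.
    by rewrite -et; apply: (QM); rewrite mulrC; apply: (QM).
  by rewrite -es; apply: (lM); [apply: (lM) => //|]; apply: (nQl).
- by rewrite !rmorphM -et -es; transitivity (l v * l u * (t * (c * a))); [ring|rewrite e; ring].
- move=> y qy; have [z ez] := tgen _ qy; have [z' [r [nr er]]] := to_local_surj z.
  have /to_local_eq[k nk ek] : l (s' * u * r * y) = l (z' * (v * t')).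
    rewrite !rmorphM -et -es -er.
    by transitivity (l v * l u * l r * (s * l y)); [ring|rewrite ez; ring].
  exists (k * (s' * u * r)), (k * z'); split; last by rewrite -!mulrA in ek *.
  rewrite /q /= !rmorphM -es.
  by do ?apply: (lM) => //; apply: (nQl).
Qed.

End LocalRing.

Section NormalRing.
Variables (A : comPzRingType) (h : A).
Hypotheses (hN : noetherian A) (hA : normal_ring A).
Hypothesis (hcodim : codim_ge (sing_locus h) 2).

(** At a height one prime [p], the fraction [1 / x] with [x] in [p] nonzero in [A_p] has a pole; its
    prime lies in [p], hence equals [p], and supplies a uniformizer [t]. If [w h = z t] with [z] in
    [p], then [p] is in the singular locus and has height at least two, which is excluded. *)
Lemma normal_squarefree : squarefree h.
Proof.
move=> p [q0 [q0p /(_ 0%N isT)[q01 nq10]]] nh2; rewrite q0p in q01 nq10.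
have [dD ic] := hA p; pose l := to_local p.
have [x px nqx] : exists2 x, p x & ~ q0 0%N x.
  apply: contrapT => nx; apply: nq10 => x px.
  by apply: contrapT => nqx; apply: nx; exists x.
have lx0 : l x != 0.
  apply/eqP => /to_local_eq0[u nu ux].
  have : q0 0%N (u * x) by rewrite ux; case: (prime_ideal (q0 0%N)).
  by move=> /primeM[/q01|].
have [|q [c [t [s [qp qx [qt nqs] _ tgen]]]]] := pole_prime (a := 1) hN dD ic lx0.
  by move=> [c e]; apply: (to_local_nunit px); exists c; rewrite mulrC.
have pq : p `<=` q.
  (* If [q] were smaller than [p], the kernel of [A -> A_p], [q] and [p] would form a chain of
     length two. *)
  apply: contrapT => npq; apply: nh2.
  have k1 : ~ [set x | l x = 0] 1 by rewrite /= rmorph1 => /eqP; rewrite oner_eq0.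
  have kM y z : l (y * z) = 0 -> l y = 0 \/ l z = 0 by rewrite rmorphM => /dD.
  have kI : is_ideal [set x | l x = 0].
    split; rewrite /mkset; first by rewrite rmorph0.
      by move=> y z ey ez; rewrite rmorphD ey ez addr0.
    by move=> y z e; rewrite rmorphM e mulr0.
  exists (fun i => if i is i'.+1 then (if i' is _.+1 then p else q) else MkSpec kI k1 kM).
  split=> // -[|[|//]] _ /=; split=> //.
    by move=> y /= ly; apply: (qx _ 0); rewrite mul0r.
  move=> /(_ x) /= H; move/eqP: lx0; apply; apply: H.
  by apply: (qx _ 1); rewrite mul1r.
have {q qp qx qt nqs tgen pq} [pt tgen] :
    p t /\ forall y, p y -> exists w z, ~ p w /\ w * y = z * t.
  split; first exact: qp.
  move=> y /pq/tgen[w [z [nw e]]]; exists w, z; split=> // pw.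
  exact/nw/pq.
have mt : ideal_gen [set l t] = max_ideal p.
  rewrite eqEsubset; split; apply: ideal_gen_min; do ?exact: ideal_gen_ideal.
    by move=> _ ->; apply: max_ideal_mem.
  move=> _ [y py <-]; apply/ideal_gen1P; have [w [z [nw e]]] := tgen _ py.
  have [v wv] := to_local_unit nw; exists (l z * v).
  apply: (unit_cancel (to_local_unit nw)).
  by rewrite -[LHS]rmorphM e rmorphM -[LHS]mul1r -wv; ring.
have [ph|nph] := pselect (p h); [right|left]; last first.
  by exists (l t), (l h); split=> //; [exact: to_local_unit|rewrite expr0 mulr1].
have [w [z [nw e]]] := tgen _ ph; have [v wv] := to_local_unit nw.
have nz : ~ p z.
  move=> pz; apply: nh2; apply: hcodim.
  by apply: (sing_locusP nw pz pt (z := 1)); rewrite mul1r.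
have [z' zz'] := to_local_unit nz.
exists (l t), (l z * v); split=> //.
  exists (l w * z').
  by transitivity (l w * v * (l z * z')); [ring|rewrite wv zz' mulr1].
apply: (unit_cancel (to_local_unit nw)).
by rewrite expr1 -[LHS]rmorphM e rmorphM -[LHS]mul1r -wv; ring.
Qed.

(* A pole of [a / b] is a height one prime at which [d] has valuation at least [2]. *)
Lemma square_denominator (p : Spec A) (d e : A) (a b : local_ring p) : h = e * d ->
    b != 0 -> (exists c, a ^+ 2 * to_local p d = c * b ^+ 2) ->
  exists c, a = c * b.
Proof.
move=> hed b0 [k ek]; have [dD ic] := hA p; apply: contrapT => nab.
have [q [c [t [s [qp qx [qt nqs] ets tgen]]]]] := pole_prime hN dD ic b0 nab.
(* [q] is locally principal, so of height at most one; for a contradiction it is put in the singular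
   locus of [h], as [t ^ 2] divides [d] in [A_q]. *)
apply: (locally_principal_height hN qt tgen); apply: hcodim.
have [k' [u [nu eu]]] := to_local_surj (c ^+ 2 * k).
have /to_local_eq[v nv ev] : to_local p (s ^+ 2 * u * d) = to_local p (k' * (t * t)).
  apply: (domain_lreg dD b0); apply: (domain_lreg dD b0).
  rewrite !rmorphM ?rmorphXn -eu.
  set L := to_local p in ets ek *.
  transitivity ((L s * b) ^+ 2 * L u * L d); first by ring.
  rewrite -ets; transitivity ((L t * c) ^+ 2 * L u * (a ^+ 2 * L d)); first by ring.
  by rewrite ek; ring.
have nq x : ~ p x -> ~ q x by move=> nx /qp.
apply: (@sing_locusP _ _ (v * (s ^+ 2 * u)) t (e * v * k') t) => //.
  by apply: prime_mul (nq _ nv) (prime_mul (prime_mul nqs nqs) (nq _ nu)).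
by rewrite hed; transitivity (e * (v * (s ^+ 2 * u * d))); [ring|rewrite ev; ring].
Qed.

End NormalRing.

(** * Splitting fields, resultants and discriminants *)

Section SplittingFields.

Lemma adjoin_root (F : fieldType) (p : {poly F}) : (1 < size p)%N ->
  exists (E : fieldType) (g : {rmorphism F -> E}) (z : E), root (map_poly g p) z.
Proof.
have [k] := ubnP (size p); elim: k => // k IH in p *; rewrite ltnS => pk p1.
have [[q q1 qp]|nq] := pselect (exists2 q : {poly F}, (1 < size q < size p)%N & q %| p).
  have /andP[q2 q3] := q1.
  have [E [g [z gz]]] := IH q (leq_trans q3 pk) q2.
  exists E, g, z; move: gz; rewrite !root_factor_theorem => gz.
  by apply: dvdp_trans gz _; rewrite dvdp_map.
have irr : irreducible_poly p.
  split=> // q q1 qp; rewrite -dvdp_size_eqp//.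
  have p0 : p != 0 by rewrite -size_poly_gt0 (ltn_trans _ p1).
  have := dvdp_leq p0 qp; rewrite leq_eqVlt => /orP[//|qlt].
  have q0 : q != 0 by apply: dvdpN0 qp p0.
  case: nq; exists q => //; rewrite qlt andbT.
  by rewrite -size_poly_gt0 in q0; case: (size q) q0 q1 => [|[]].
have [L _ [z zp _]] := irredp_FAdjoin irr.
by exists L, (in_alg L : {rmorphism F -> L}), z.
Qed.

Lemma splitting_field (F : fieldType) (p : {poly F}) : p \is monic ->
  exists (E : fieldType) (g : {rmorphism F -> E}) (rs : seq E),
    map_poly g p = \prod_(r <- rs) ('X - r%:P).
Proof.
have [k] := ubnP (size p); elim: k => // k IH in F p *; rewrite ltnS => pk pm.
have [p1|p1] := leqP (size p) 1.
  exists F, (idfun : {rmorphism F -> F}), [::]; rewrite big_nil.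
  by move: pm; rewrite (size1_polyC p1) monicE lead_coefC => /eqP->; rewrite map_polyC.
have [E [g [z /factor_theorem[q qE]]]] := adjoin_root p1.
have qm : q \is monic by rewrite -(monicMr q (monicXsubC z)) -qE map_monic.
have [|L [h [rs rsE]]] := IH E q _ qm.
  have := size_map_poly g p; rewrite qE size_Mmonic ?monicXsubC ?monic_neq0//.
  by rewrite size_XsubC addn2 /= => e; rewrite -ltnS e ltnS.
exists L, (h \o g : {rmorphism F -> L}), (h z :: rs).
rewrite map_poly_comp qE rmorphM /= rsE big_cons mulrC; congr (_ * _).
by rewrite rmorphB /= map_polyX map_polyC.
Qed.

(** The [eta i] are found by splitting the product of the [X^2 - r] over the roots [r] of [p].
    Comparing constant terms gives their product up to sign. *)
Lemma square_splitting_field (F : fieldType) (n : nat) (p : {poly F}) (c : F) :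
    (0 < n)%N -> p \is monic -> size p = n.+1 -> c ^+ 2 = (-1) ^+ n * p`_0 ->
  exists (E : fieldType) (g : {rmorphism F -> E}) (eta : 'I_n -> E),
    map_poly g p = \prod_i ('X - (eta i ^+ 2)%:P) /\ \prod_i eta i = g c.
Proof.
move=> n0 pm pn cE; have [E [g [rs rsE]]] := splitting_field pm.
have srs : size rs = n.
  by have := size_map_poly g p; rewrite rsE size_prod_XsubC pn => -[].
have sm : \prod_(r <- rs) ('X^2 - r%:P) \is monic.
  by apply: monic_prod => r _; rewrite monicE lead_coefXnsubC.
have [L [h [ts tsE]]] := splitting_field sm.
have /choice[s sE] : forall i : 'I_n, exists s, s ^+ 2 = h rs`_i.
  move=> i; have : 'X^2 - (h rs`_i)%:P %| \prod_(r <- ts) ('X - r%:P).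
    rewrite -tsE rmorph_prod; have ri : rs`_i \in rs by rewrite mem_nth// srs.
    rewrite (big_rem _ ri)/= rmorphB /= map_polyXn map_polyC.
    exact: dvdp_mulr.
  move=> /dvdp_prod_XsubC[m em]; have := eqp_size em.
  rewrite size_XnsubC// size_prod_XsubC; case: (mask m ts) em => // t ms em _.
  exists t; apply/eqP; rewrite -subr_eq0.
  have : root ('X^2 - (h rs`_i)%:P) t.
    by rewrite (eqp_root em) root_prod_XsubC inE eqxx.
  by rewrite /root !hornerE.
have hg : map_poly (h \o g) p = \prod_i ('X - (s i ^+ 2)%:P).
  rewrite map_poly_comp rsE rmorph_prod (big_nth 0) srs big_mkord.
  by apply: eq_bigr => i _; rewrite rmorphB /= map_polyX map_polyC sE.
have s2 : (\prod_i s i) ^+ 2 = h (g c) ^+ 2.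
  rewrite -!rmorphXn cE !rmorphM !rmorphXn !rmorphN1 /= -prodrXl.
  have -> : h (g p`_0) = (map_poly (h \o g) p)`_0 by rewrite coef_map.
  rewrite hg -horner_coef0 horner_prod -[n in (-1) ^+ n]card_ord -prodrN.
  by apply: eq_bigr => i _; rewrite !hornerE opprK.
exists L, (h \o g : {rmorphism F -> L}).
move/eqP: s2; rewrite eqf_sqr => /orP[/eqP e|/eqP e]; first by exists s.
case: n n0 {pn cE srs} s sE hg e => // n _ s sE hg e.
(* Flipping the sign of one root corrects the product and leaves the squares unchanged. *)
exists (fun i => if i == ord0 then - s i else s i); split.
  by rewrite hg; apply: eq_bigr => i _; case: eqP => // _; rewrite sqrrN.
by rewrite /= -[RHS]opprK -e !big_ord_recl eqxx mulNr; congr (- (_ * _)); apply: eq_bigr.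
Qed.

End SplittingFields.

(** * Resultants and discriminants in terms of roots *)

Section Resultant.
Variables (A : comNzRingType) (E : idomainType) (phi : {rmorphism A -> E}).
Variables (n : nat) (p q : {poly A}) (r : 'I_n -> E).
Hypotheses (n0 : (0 < n)%N) (qm : q \is monic).
Hypothesis (qr : map_poly phi q = \prod_i ('X - (r i)%:P)).
Local Notation m := (size p).-1.

(** A block of Sylvester rows: row [i] holds the coefficients of [X^i s]. Multiplication by [powers]
    evaluates the rows at the [r j]. *)
Let band (k : nat) (s : {poly A}) : 'M[E]_(k, n + m) :=
  \matrix_(i, j) phi (s`_(j - i) *+ (i <= j)%N).

Let powers : 'M[E]_(n + m, n) := \matrix_(i, j) r j ^+ i.

Let size_q : size q = n.+1.
Proof.
have := size_map_poly_id0 (f := phi) (p := q).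
by rewrite (monicP qm) rmorph1 oner_eq0 qr size_prod_XsubC
  [index_enum _]unlock -enumT size_enum_ord => ->.
Qed.

Let band_powers k (s : {poly A}) (i : 'I_k) (j : 'I_n) : (i + size s <= n + m)%N ->
  (band k s *m powers) i j = r j ^+ i * (map_poly phi s).[r j].
Proof.
move=> le; rewrite -hornerXn -hornerM (@horner_coef_wide _ (n + m)).
  rewrite mxE; apply: eq_bigr => l _; rewrite !mxE coefXnM coef_map.
  by rewrite ltnNge; case: leqP => _; rewrite ?mulr1n// mulr0n rmorph0.
apply: leq_trans (size_polyMleq _ _) _; rewrite size_polyXn /=.
by apply: leq_trans le; rewrite leq_add2l size_poly.
Qed.

Let resultantE : phi (resultant p q) = \det (col_mx (band n p) (band m q)).
Proof.
suff H n' (e : (size q).-1 = n') :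
    phi (resultant p q) = \det (col_mx
      (\matrix_(i < n', j < n' + m) phi (p`_(j - i) *+ (i <= j)%N))
      (\matrix_(i < m, j < n' + m) phi (q`_(j - i) *+ (i <= j)%N))).
  by apply: H; rewrite size_q.
subst n'; rewrite /resultant -det_map_mx; congr (\det _).
apply/matrixP => i j; rewrite mxE Sylvester_mxE.
rewrite -[i in RHS]splitK.
by case: (split i) => k /=; rewrite ?col_mxEu ?col_mxEd mxE.
Qed.

Let band_p : band n p *m powers =
  Vandermonde n (\row_i r i) *m diag_mx (\row_j (map_poly phi p).[r j]).
Proof.
apply/matrixP => i j; rewrite band_powers; first by rewrite mul_mx_diag !mxE.
apply: leq_trans (_ : i.+1 + m <= _)%N; last by rewrite leq_add2r.
by rewrite addSnnS leq_add2l leqSpred.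
Qed.

Let band_q : band m q *m powers = 0.
Proof.
apply/matrixP => i j; rewrite band_powers.
  by rewrite qr horner_prod (bigD1 j)//= hornerXsubC subrr mul0r mulr0 mxE.
by rewrite size_q addnS -addSn addnC leq_add2l.
Qed.

(** The powers of a common root form a nonzero vector killed by the Sylvester matrix. This serves
    discriminants with repeated roots. *)
Lemma resultant_root (i : 'I_n) : (map_poly phi p).[r i] = 0 -> phi (resultant p q) = 0.
Proof.
move=> pr; rewrite resultantE -det_tr; apply/eqP/det0P; exists ((col i powers)^T).
  apply/eqP => /rowP/(_ (lshift m (Ordinal n0))).
  by rewrite !mxE expr0 => /eqP; rewrite oner_eq0.
rewrite -trmx_mul mul_col_mx !colE !mulmxA -!colE band_q band_p.
apply/matrixP => a b; rewrite 3!mxE; case: splitP => k _; rewrite !mxE//.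
rewrite (bigD1 i)//= big1 => [|l /negPf li]; rewrite !mxE ?eqxx ?pr ?mulr0 ?addr0//.
by rewrite li mulr0n mulr0.
Qed.

(** The Sylvester matrix times [W], of determinant [\det V], is block triangular; its diagonal
    blocks are [V] times the diagonal matrix of the values of [p], and a unitriangular matrix.
    Distinct roots allow cancelling [\det V]. *)
Lemma resultant_roots : injective r ->
  phi (resultant p q) = \prod_i (map_poly phi p).[r i].
Proof.
move=> rinj; pose V := Vandermonde n (\row_i r i).
have V0 : \det V != 0.
  rewrite det_Vandermonde; apply/prodf_neq0 => i _; apply/prodf_neq0 => j ij.
  rewrite !mxE subr_eq0; apply: contraTneq ij => /rinj ->.
  by rewrite ltnn.
pose W := block_mx (usubmx powers) 0 (dsubmx powers) 1%:M.
have detW : \det W = \det V.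
  rewrite det_lblock det1 mulr1; congr (\det _).
  by apply/matrixP => i j; rewrite !mxE.
apply: (mulIf V0); rewrite resultantE -{1}detW -det_mulmx.
have -> : W = row_mx powers (col_mx 0 1%:M).
  by rewrite /W block_mxEh vsubmxK.
rewrite mul_col_row band_q det_ublock band_p det_mulmx det_diag.
have -> : band m q *m col_mx 0 1%:M = rsubmx (band m q).
  by rewrite -{1}[band m q]hsubmxK mul_row_col mulmx0 add0r mulmx1.
have -> : \det (rsubmx (band m q)) = 1.
  rewrite det_trig => [|].
    apply: big1 => i _; rewrite !mxE leq_addl addnK mulr1n.
    by have /monicP := qm; rewrite lead_coefE size_q => ->; rewrite rmorph1.
  apply/is_trig_mxP => i j ij; rewrite !mxE nth_default ?mul0rn ?rmorph0//.
  by rewrite size_q ltn_subRL addnC ltn_add2l.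
by rewrite mulr1 mulrC; congr (_ * _); apply: eq_bigr => i _; rewrite mxE.
Qed.

End Resultant.

(** The derivative of [g] at [r i] is the product of the [r i - r j] with [j != i]; over all [i],
    each pair occurs twice, with opposite signs. With a repeated root both sides vanish. *)
Lemma discriminant_roots (A : comNzRingType) (E : idomainType) (phi : {rmorphism A -> E})
    (n : nat) (g : {poly A}) (r : 'I_n -> E) : (0 < n)%N -> g \is monic ->
    map_poly phi g = \prod_i ('X - (r i)%:P) ->
  exists k, phi (discriminant g) = (-1) ^+ k * \det (Vandermonde n (\row_i r i)) ^+ 2.
Proof.
move=> n0 gm gr; set V := \det _.
have dg i : (map_poly phi g^`()).[r i] = \prod_(j | j != i) (r i - r j).
  rewrite -deriv_map gr (bigD1 i)//= derivM derivXsubC mul1r hornerD hornerM.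
  rewrite hornerXsubC subrr mul0r addr0 horner_prod. apply: eq_bigr => j _.
  by rewrite hornerXsubC.
have -> : phi (discriminant g) = (-1) ^+ 'C((size g).-1, 2) * phi (resultant g^`() g).
  by rewrite rmorphM rmorphXn rmorphN1.
have VE : V = \prod_(i < n) \prod_(j < n | (i < j)%N) (r j - r i).
  rewrite /V det_Vandermonde; apply: eq_bigr => i _.
  by apply: eq_bigr => j _; rewrite !mxE.
have [rinj|/existsNP[i /existsNP[j /not_implyP[e ij]]]] := pselect (injective r); last first.
  exists 0%N; rewrite (@resultant_root _ _ _ _ _ _ r _ _ _ i)//; last first.
    rewrite dg (bigD1 j)/=; first by rewrite e subrr mul0r.
    by apply/eqP => ji; apply: ij.
  suff -> : V = 0 by rewrite expr0n !mulr0.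
  wlog lt_ij : i j e ij / (i < j)%N => [H|].
    have [|/H|] := ltngtP i j; [exact: H| |by move/val_inj/ij].
    by apply=> // ji; apply: ij.
  by rewrite VE (bigD1 i)//= (bigD1 j)//= e subrr !mul0r.
rewrite (resultant_roots _ gm gr rinj).
exists ('C((size g).-1, 2) + \sum_(i < n) #|[pred j : 'I_n | (i < j)%N]|)%N.
rewrite exprD -mulrA; congr (_ * _).
under eq_bigr do rewrite dg.
have split_prod (i : 'I_n) : \prod_(j | j != i) (r i - r j) =
    (\prod_(j < n | (i < j)%N) (r i - r j)) * \prod_(j < n | (j < i)%N) (r i - r j).
  rewrite (bigID (fun j : 'I_n => (i < j)%N))/=.
  by congr (_ * _); apply: eq_bigl => j; rewrite -val_eqE/=; case: ltngtP.
under eq_bigr do rewrite split_prod.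
rewrite big_split /= expr2 mulrA; congr (_ * _); last first.
  rewrite VE (exchange_big_dep xpredT)//=.
rewrite VE -prodrXr -big_split /=; apply: eq_bigr => i _.
by rewrite -prodrN; apply: eq_bigr => j _; rewrite opprB.
Qed.

(** * Even signed permutations *)

Lemma mpoly_rmorph_eq (A S : comNzRingType) (n : nat) (f g : {rmorphism {mpoly A[n]} -> S}) :
    (forall c, f c%:MP = g c%:MP) -> (forall i, f 'X_i = g 'X_i) -> f =1 g.
Proof.
move=> fgC fgX z; rewrite (mpolyE z) !rmorph_sum; apply: eq_bigr => m _.
rewrite -mul_mpolyC !rmorphM fgC; congr (_ * _).
rewrite mpolyXE_id !rmorph_prod; apply: eq_bigr => i _.
by rewrite !rmorphXn fgX.
Qed.

Section ElementarySymmetric.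
Variable n : nat.

Definition elsym (S : comNzRingType) (h : 'I_n -> S) (k : nat) : S :=
  \sum_(s : {set 'I_n} | #|s| == k) \prod_(i in s) h i.

Lemma rmorph_elsym (S T : comNzRingType) (g : {rmorphism S -> T}) h k :
  g (elsym h k) = elsym (g \o h) k.
Proof. by rewrite rmorph_sum; apply: eq_bigr => s _; rewrite rmorph_prod. Qed.

Lemma mmap_mesym (R S : comNzRingType) (f : {rmorphism R -> S}) (h : 'I_n -> S) k :
  mmap f h (mesym n R k) = elsym h k.
Proof.
rewrite /mesym rmorph_sum; apply: eq_bigr => s _.
by rewrite rmorph_prod; apply: eq_bigr => i _; rewrite /= mmapX mmap1U.
Qed.

(** The universal identity over the integers, specialized at [h]. *)
Lemma prod_XsubC_elsym (S : comNzRingType) (h : 'I_n -> S) :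
  \prod_i ('X - (h i)%:P) = \sum_(k < n.+1) ((-1) ^+ k * elsym h k) *: 'X^(n - k).
Proof.
pose f : {rmorphism {mpoly int[n]} -> S} := mmap (intr : {rmorphism int -> S}) h.
have := congr1 (map_poly f) (Viete n); rewrite rmorph_prod rmorph_sum => fV.
transitivity (\prod_(i < n) map_poly f ('X - ('X_i)%:P)).
  apply: eq_bigr => i _; rewrite rmorphB /= map_polyX map_polyC /=.
  by rewrite mmapX mmap1U.
rewrite fV; apply: eq_bigr => k _.
rewrite scalerA /= map_polyZ map_polyXn; congr (_ *: _).
by rewrite rmorphM rmorphXn rmorphN1 /= mmap_mesym.
Qed.

Lemma elsym0 (S : comNzRingType) (h : 'I_n -> S) : elsym h 0 = 1.
Proof.
rewrite /elsym (bigD1 (finset.set0 : {set 'I_n})) ?cards0//= big_set0 big1 ?addr0// => s.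
by rewrite cards_eq0 => /andP[->].
Qed.

Lemma elsymn (S : comNzRingType) (h : 'I_n -> S) : elsym h n = \prod_i h i.
Proof.
rewrite /elsym (bigD1 (finset.setTfor 'I_n))/= ?finset.cardsT ?card_ord//.
rewrite [X in _ + X]big1 ?addr0 => [|s].
  by apply: eq_bigl => i; rewrite inE.
move=> /andP[/eqP sn /eqP[]]; apply/eqP.
by rewrite eqEcard finset.subsetT finset.cardsT card_ord sn leqnn.
Qed.

End ElementarySymmetric.

Lemma prod_sign (S : comNzRingType) (I : finType) (e : I -> bool) :
  \prod_i (-1) ^+ e i = (-1) ^+ (\big[addb/false]_i e i) :> S.
Proof.
apply: (big_ind2 (fun (x : S) (b : bool) => x = (-1) ^+ b)) => // x b y c -> ->.
by rewrite signr_addb.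
Qed.

Lemma lreg_prod (S : comNzRingType) (I : Type) (r : seq I) (p : pred I) (F : I -> S) :
  (forall i, p i -> GRing.lreg (F i)) -> GRing.lreg (\prod_(i <- r | p i) F i).
Proof. by apply: big_ind; [exact: lreg1|exact: lregM]. Qed.

Section SignedPermutations.
Variables (A : comNzRingType) (n : nat).
Local Notation P := {mpoly A[n]}.

Lemma lregX (m : 'X_{1..n}) : GRing.lreg ('X_[m] : P).
Proof. by apply: lreg_mleadc; rewrite mleadXm mcoeffX eqxx; apply: lreg1. Qed.

(** As [A] may have zero divisors, regularity is read off the leading coefficient, which is [1] up
    to sign. *)
Lemma lregXX (m1 m2 : 'X_{1..n}) : m1 != m2 -> GRing.lreg ('X_[m1] - 'X_[m2] : P).
Proof.
wlog lt : m1 m2 / (m2 < m1)%O => [H|] m12.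
  have [|lt|e] := Order.TotalTheory.ltgtP m1 m2; last by rewrite e eqxx in m12.
    by move=> lt; rewrite -opprB; apply: lregN; apply: H => //; rewrite eq_sym.
  exact: H.
apply: lreg_mleadc; rewrite mleadDl ?mleadN ?mleadXm//.
rewrite mcoeffB !mcoeffX eqxx eq_sym (negPf m12) subr0; exact: lreg1.
Qed.

Lemma mpolyX_inj (i j : 'I_n) (a : A) : a *: 'X_i = 'X_j :> P -> i = j /\ a = 1.
Proof.
move=> e; have := congr1 (mcoeff U_(j)) e.
rewrite mcoeffZ !mcoeffXU eqxx; case: eqP => [->|_]; first by rewrite mulr1.
by rewrite mulr0 => /esym/eqP; rewrite oner_eq0.
Qed.

(* [(s, e)] maps the variable [x_i] to [(-1) ^ e_i x_(s i)]. *)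
Definition signed_perm := ('S_n * {ffun 'I_n -> bool})%type.

Definition sp_even (w : signed_perm) : bool := ~~ \big[addb/false]_i w.2 i.

Definition sp_var (w : signed_perm) (i : 'I_n) : P := (-1) ^+ w.2 i *: 'X_(w.1 i).

Definition sp_act (w : signed_perm) : {rmorphism P -> P} :=
  mmap (@mpolyC n A) (sp_var w).

Definition sp1 : signed_perm := (1%g, [ffun=> false]).

Lemma sp_actC w c : sp_act w c%:MP = c%:MP.
Proof. exact: mmapC. Qed.

Lemma sp_actX w i : sp_act w 'X_i = sp_var w i.
Proof. by rewrite /= mmapX mmap1U. Qed.

Lemma sp_act1 z : sp_act sp1 z = z.
Proof.
apply: (mpoly_rmorph_eq (g := idfun)) => [c|i]; first exact: sp_actC.
by rewrite sp_actX /sp_var /sp1 /= ffunE perm1 scale1r.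
Qed.

Lemma sp_var_even w : sp_even w -> \prod_i sp_var w i = \prod_i 'X_i.
Proof.
move=> we; rewrite scaler_prod prod_sign (negPf we) scale1r.
by rewrite [RHS](reindex_inj (@perm_inj _ w.1)).
Qed.

Lemma sp_var_fixed w i : (2 : A) != 0 -> sp_var w i = 'X_i -> w.1 i = i /\ w.2 i = false.
Proof.
move=> two /mpolyX_inj[-> e]; split=> //; case: (w.2 i) e => // e.
by case/eqP: two; rewrite mulr2n -{1}e expr1 addNr.
Qed.

End SignedPermutations.

Lemma horner_sub0 (R : comNzRingType) (p : {poly R}) :
  exists q : {poly R}, forall z, z * q.[z] = p.[z] - p.[0].
Proof.
have /factor_theorem[q e] : root (p - p.[0]%:P) 0 by rewrite /root !hornerE subrr.
exists q => z; have := congr1 (horner^~ z) e.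
by rewrite hornerM hornerXsubC subr0 hornerD hornerN hornerC mulrC => ->.
Qed.

(** * The kernel [D(x, y)] *)

Section Kernel.
Variables (A : comNzRingType) (n : nat).
Hypothesis two : (2 : A) != 0.
Local Notation P := {mpoly A[n]}.
Local Notation W := (signed_perm n).

(* [F w] is the value at [(x, w x)] of a polynomial in [2 n] variables. *)
Definition representable (F : W -> P) : Prop :=
  exists bs : seq (P * P), forall w, F w = \sum_(b <- bs) b.1 * sp_act A w b.2.

Lemma eq_representable F G : F =1 G -> representable F -> representable G.
Proof. by move=> FG [bs e]; exists bs => w; rewrite -FG. Qed.

Lemma representable_const (z : P) : representable (fun=> z).
Proof. by exists [:: (z, 1)] => w; rewrite big_seq1 rmorph1 mulr1. Qed.

Lemma representable_act (z : P) : representable (fun w => sp_act A w z).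
Proof. by exists [:: (1, z)] => w; rewrite big_seq1 mul1r. Qed.

Lemma representableD F G : representable F -> representable G ->
  representable (fun w => F w + G w).
Proof. by move=> [bs Fb] [cs Gc]; exists (bs ++ cs) => w; rewrite big_cat Fb Gc. Qed.

Lemma representableM F G : representable F -> representable G ->
  representable (fun w => F w * G w).
Proof.
move=> [bs Fb] [cs Gc]; exists [seq (b.1 * c.1, b.2 * c.2) | b <- bs, c <- cs] => w.
rewrite big_allpairs_dep Fb Gc mulr_suml; apply: eq_bigr => b _.
rewrite mulr_sumr; apply: eq_bigr => c _.
by rewrite /= rmorphM mulrACA.
Qed.

Lemma representable_prod (I : Type) (s : seq I) (F : I -> W -> P) :
  (forall i, representable (F i)) -> representable (fun w => \prod_(i <- s) F i w).
Proof.
move=> rF; elim: s => [|i s IH].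
  by apply: eq_representable (representable_const 1) => w; rewrite big_nil.
by apply: eq_representable (representableM (rF i) IH) => w; rewrite big_cons.
Qed.

Lemma representable_horner (q : {poly P}) (F : W -> P) : representable F ->
  representable (fun w => q.[F w]).
Proof.
move=> rF; elim/poly_ind: q => [|q c IH].
  by apply: eq_representable (representable_const 0) => w; rewrite horner0.
apply: eq_representable (representableD (representableM IH rF) (representable_const c)).
by move=> w; rewrite hornerMXaddC.
Qed.

(* With [y = w x], [G(t) = prod_(j > k) (t^2 - x_j^2)] and [N(t) = (G(t) - G(0)) / t], the
   factor is [G(y_k) + x_k N(y_k) + (-1)^(n - 1 - k) prod_(j > k) x_j y_j]. It is zero because
   [x_k prod_(j > k) x_j = y_k prod_(j > k) y_j] when [w] is even and fixes [x_j] for [j < k]. *)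
Lemma kernel_factor (k : 'I_n) : exists F : W -> P,
  [/\ representable F,
      F (sp1 n) = 2 * \prod_(j < n | (k < j)%N) ('X_k ^+ 2 - 'X_j ^+ 2)
    & forall w, sp_even w -> (forall j : 'I_n, (j < k)%N -> sp_var A w j = 'X_j) ->
        sp_var A w k != 'X_k -> F w = 0].
Proof.
pose G : {poly P} := \prod_(j < n | (k < j)%N) ('X^2 - ('X_j ^+ 2)%:P).
have GE z : G.[z] = \prod_(j < n | (k < j)%N) (z ^+ 2 - 'X_j ^+ 2).
  by rewrite horner_prod; apply: eq_bigr => j _; rewrite !hornerE.
have [N NE] := horner_sub0 G.
move: GE NE; move: G => G GE NE.
pose xi : P := \prod_(j < n | (k < j)%N) 'X_j.
pose c : P := \prod_(j < n | (k < j)%N) (-1).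
have G0 : G.[0] = c * xi ^+ 2.
  rewrite GE -prodrXl -big_split; apply: eq_bigr => j _ /=.
  by rewrite expr0n sub0r mulN1r.
exists (fun w => G.[sp_act A w 'X_k] + 'X_k * N.[sp_act A w 'X_k] + c * xi * sp_act A w xi).
split.
- apply: representableD; last exact: representableM (representable_const _) (representable_act _).
  apply: representableD; first exact: representable_horner (representable_act _).
  apply: representableM (representable_const _) _.
  exact: representable_horner (representable_act _).
- by rewrite !sp_act1 NE G0 -GE; ring.
move=> w we wj; rewrite sp_actX; set y := sp_var A w k => yk.
set u := sp_act A w xi.
have uE : u = \prod_(j < n | (k < j)%N) sp_var A w j.
  by rewrite /u rmorph_prod; apply: eq_bigr => j _; rewrite sp_actX.
have yu : y * u = 'X_k * xi.
  have split3 (h : 'I_n -> P) : \prod_i h i =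
      (\prod_(j < n | (j < k)%N) h j) * (h k * \prod_(j < n | (k < j)%N) h j).
    rewrite (bigID (fun j : 'I_n => (j < k)%N))/=; congr (_ * _).
    rewrite (bigD1 k) ?ltnn//=; congr (_ * _); apply: eq_bigl => j.
    by rewrite -leqNgt [in RHS]ltn_neqAle andbC eq_sym -val_eqE.
  have := sp_var_even A we; rewrite !split3 -uE (eq_bigr _ wj).
  exact: (lreg_prod (fun j _ => @lregX A n U_(j)%MM)).
have wk : (k <= w.1 k)%N.
  rewrite leqNgt; apply/negP => lt; have [+ _] := sp_var_fixed two (wj _ lt).
  by move=> /perm_inj e; rewrite e ltnn in lt.
have yy : y ^+ 2 = 'X_(w.1 k) ^+ 2 by rewrite /y /sp_var exprZn sqrr_sign scale1r.
(* If [w] fixes the index [k], it changes the sign of [x_k], so [y = - x_k] and [u = - xi].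
   Otherwise it sends [k] to a larger index, [G] vanishes at [y], and the identity is checked after
   multiplication by the regular element [y]. *)
have [e|ne] := eqVneq (w.1 k) k.
  have yX : y = - 'X_k.
    move: yk; rewrite /y /sp_var e; case: (w.2 k); last by rewrite scale1r eqxx.
    by rewrite expr1 scaleN1r.
  have -> : u = - xi by apply: (@lregX A n U_(k)%MM); rewrite -[_ * u]opprK -mulNr -yX yu mulrN.
  have := NE y; rewrite {1}yX mulNr => /eqP; rewrite eqr_oppLR => /eqP->.
  by rewrite G0; ring.
have Gy : G.[y] = 0.
  rewrite GE (bigD1 (w.1 k)); first by rewrite /= yy subrr mul0r.
  by rewrite /= ltn_neqAle wk eq_sym val_eqE ne.
have ry : GRing.lreg y.
  rewrite /y /sp_var -mulr_algl; apply: lregM (@lregX A n _).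
  by rewrite -in_algE rmorph_sign; apply: lreg_sign.
apply: ry; rewrite Gy mulr0 add0r mulrDr mulrCA NE Gy G0.
transitivity (c * xi * ('X_k * - xi + y * u)); first by ring.
by rewrite yu; ring.
Qed.

(** Take the product of the kernel factors: for [w] other than the identity, the factor at the least
    [k] with [x_k] moved vanishes. *)
Lemma kernel : exists D : W -> P,
  [/\ representable D,
      D (sp1 n) = 2 ^+ n * \prod_(i < n) \prod_(j < n | (i < j)%N) ('X_i ^+ 2 - 'X_j ^+ 2)
    & forall w, sp_even w -> w != sp1 n -> D w = 0].
Proof.
have /choice[F FP] := kernel_factor.
exists (fun w => \prod_k F k w); split.
- by apply: representable_prod => k; case: (FP k).
- rewrite -[n in 2 ^+ n]card_ord -prodr_const -big_split; apply: eq_bigr => k _.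
  by case: (FP k).
move=> w we w1.
have [k0 k0P] : exists k, sp_var A w k != 'X_k.
  apply: contrapT => nk; case/eqP: w1.
  have wk k : w.1 k = k /\ w.2 k = false.
    by apply: (sp_var_fixed two); apply/eqP/negPn/negP => wk; apply: nk; exists k.
  case: w wk {we nk} => s e /= wk; congr (_, _).
    by apply/permP => k; rewrite perm1; case: (wk k).
  by apply/ffunP => k; rewrite ffunE; case: (wk k).
pose moved k := sp_var A w k != 'X_k.
have [k kP kmin] := @arg_minnP _ k0 moved (fun k : 'I_n => k : nat) k0P.
rewrite (bigD1 k)//=; have [_ _ ->//] := FP k; first by rewrite mul0r.
move=> j jk; apply/eqP/negPn/negP => /kmin; by rewrite leqNgt jk.
Qed.

End Kernel.

Record is_subring (R : comNzRingType) (S : R -> Prop) : Prop := IsSubring {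
  subring1 : S 1;
  subringB : forall x y, S x -> S y -> S (x - y);
  subringM : forall x y, S x -> S y -> S (x * y) }.

Section Subring.
Variables (R : comNzRingType) (S : R -> Prop).
Hypothesis hS : is_subring S.

Lemma subring0 : S 0.
Proof. by rewrite -(subrr 1); apply: subringB => //; apply: subring1. Qed.

Lemma subringN x : S x -> S (- x).
Proof. by move=> Sx; rewrite -sub0r; apply: subringB => //; apply: subring0. Qed.

Lemma subringD x y : S x -> S y -> S (x + y).
Proof. by move=> Sx Sy; rewrite -[y]opprK; apply: subringB => //; apply: subringN. Qed.

Lemma subring_sum (I : Type) (s : seq I) (p : pred I) (F : I -> R) :
  (forall i, p i -> S (F i)) -> S (\sum_(i <- s | p i) F i).
Proof. by apply: big_ind; [exact: subring0|exact: subringD]. Qed.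

Lemma subring_prod (I : Type) (s : seq I) (p : pred I) (F : I -> R) :
  (forall i, p i -> S (F i)) -> S (\prod_(i <- s | p i) F i).
Proof. by apply: big_ind; [exact: subring1|exact: subringM]. Qed.

Lemma subring_sign (k : nat) : S ((-1) ^+ k).
Proof.
elim: k => [|k IH]; first exact: subring1.
by rewrite exprS mulN1r; apply: subringN.
Qed.

Lemma subring_det n (M : 'M[R]_n) : (forall i j, S (M i j)) -> S (\det M).
Proof.
move=> SM; apply: subring_sum => s _; apply: subringM => //; first exact: subring_sign.
by apply: subring_prod => i _.
Qed.

(* Division of [X ^ m] by [\prod_i ('X - (h i)%:P)]. *)
Lemma power_reduction n (h : 'I_n -> R) (m : nat) : (forall k, S (elsym h k)) ->
  exists c : 'I_n -> R, (forall k, S (c k)) /\ forall i, h i ^+ m = \sum_k c k * h i ^+ k.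
Proof.
move=> Sh; case: n => [|n] in h Sh *.
  by exists (fun=> 0); split=> [|[]//]; move=> []//.
elim: m => [|m [c [Sc cE]]].
  exists (fun k => (k == ord0)%:R); split=> [k|i].
    by case: eqP => _; [exact: subring1|exact: subring0].
  rewrite big_ord_recl eqxx mul1r big1 ?addr0// => k _.
  by rewrite [_ == _]negbTE ?mul0r.
pose d k := (-1) ^+ k * elsym h k.
have hE i : h i ^+ n.+1 = - \sum_(k < n.+1) d (n.+1 - k)%N * h i ^+ k.
  have : (\prod_j ('X - (h j)%:P)).[h i] = 0.
    by rewrite horner_prod (bigD1 i)//= hornerXsubC subrr mul0r.
  rewrite prod_XsubC_elsym horner_sum (reindex_inj rev_ord_inj) big_ord_recr /=.
  rewrite subnn elsym0 expr0 mulr1 scale1r subn0 hornerXn => /eqP.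
  rewrite addrC addr_eq0 => /eqP->; congr (- _); apply: eq_bigr => k _.
  by rewrite hornerZ hornerXn /= subKn // ltnW.
(* Multiplication by [h i] shifts the coefficients up by one, and the top term is rewritten by
   [hE]. *)
exists (fun k => (if unlift ord0 k is Some j then c (widen_ord (leqnSn n) j) else 0)
                 - c ord_max * d (n.+1 - k)%N); split=> [k|i].
  apply: subringB => //; first by case: unlift => *; [exact: Sc|exact: subring0].
  by do 2?apply: subringM => //; exact: subring_sign.
under eq_bigr do rewrite mulrBl -mulrA; rewrite sumrB -mulr_sumr.
rewrite exprSr cE mulr_suml big_ord_recr /= -mulrA -exprSr hE mulrN; congr (_ - _).
rewrite big_ord_recl unlift_none mul0r add0r; apply: eq_bigr => k _.
by rewrite liftK -mulrA -exprSr.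
Qed.

End Subring.

(** * Antisymmetrization over even signed permutations *)

Section Antisymmetrization.
Variables (A : comNzRingType) (n : nat).
Hypothesis two : is_unit (2 : A).
Local Notation P := {mpoly A[n]}.
Local Notation W := (signed_perm n).

(** The product [V] of the overview, as a Vandermonde determinant in the squares. *)
Definition vdm : P := \det (Vandermonde n (\row_i ('X_i ^+ 2 : P))).

Lemma lreg_vdm : GRing.lreg vdm.
Proof.
rewrite /vdm det_Vandermonde; apply: lreg_prod => i _; apply: lreg_prod => j ij.
rewrite !mxE !mpolyXn; apply: lregXX; apply: contraTneq ij => e.
have := congr1 (fun m : 'X_{1..n} => m j) e.
by rewrite !mulmnE !mnm1E eqxx; case: eqP => [->|]; rewrite ?ltnn.
Qed.

(** The sign is that of the permutation alone, as sign changes leave [vdm] fixed. *)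
Definition antisym (u : P) : P :=
  \sum_(w : W | sp_even w) (-1) ^+ (w.1 : bool) * sp_act A w u.

Lemma antisymD u v : antisym (u + v) = antisym u + antisym v.
Proof. by rewrite -big_split; apply: eq_bigr => w _; rewrite rmorphD mulrDr. Qed.

Lemma antisymZ c u : antisym (c *: u) = c *: antisym u.
Proof.
rewrite scaler_sumr; apply: eq_bigr => w _.
by rewrite -mul_mpolyC rmorphM sp_actC mulrCA mul_mpolyC.
Qed.

(** Each term is the sign by which the sign change [e] acts on the monomial [m]. *)
Definition sign_sum (m : 'X_{1..n}) : A :=
  \sum_(e : {ffun 'I_n -> bool} | ~~ \big[addb/false]_i e i)
    \prod_i (-1) ^+ (e i && odd (m i)).

Lemma antisymX (m : 'X_{1..n}) : antisym 'X_[m] =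
  sign_sum m *: \sum_(s : 'S_n) (-1) ^+ (s : bool) * \prod_i 'X_(s i) ^+ m i.
Proof.
rewrite /antisym; rewrite scaler_suml.
under [RHS]eq_bigr do rewrite scaler_sumr.
rewrite exchange_big pair_big_dep /=.
apply: eq_big => [[s e]//|[s e] _] /=.
rewrite mmapX scalerAr; congr (_ * _).
rewrite /mmap1 -scaler_prod; apply: eq_bigr => i _.
rewrite /sp_var exprZn -exprM; congr (_ *: _).
by case: (e i); rewrite ?mul1n ?mul0n ?expr0//= signr_odd.
Qed.

(** Flipping the signs at both [i] and [j] preserves evenness and negates every term, so the sum
    equals its opposite; [2] is invertible. *)
Lemma sign_sum_mixed (m : 'X_{1..n}) i j : odd (m i) -> ~~ odd (m j) -> sign_sum m = 0.
Proof.
move=> mi mj; have ij : i != j by apply: contraTneq mi => ->.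
pose d k := (k == i) || (k == j).
pose f (e : {ffun 'I_n -> bool}) := [ffun k => e k (+) d k].
have fK : involutive f by move=> e; apply/ffunP => k; rewrite !ffunE addbK.
have sE : sign_sum m = - sign_sum m.
  rewrite {1}/sign_sum (reindex_inj (inv_inj fK)) /= -sumrN.
  have par e : \big[addb/false]_k f e k = \big[addb/false]_k e k.
    under eq_bigr do rewrite ffunE.
    have di : d i by rewrite /d eqxx.
    have dj : d j by rewrite /d eqxx orbT.
    rewrite big_split /=; have -> : \big[addb/false]_k d k = false.
      rewrite (bigD1 i)//= (bigD1 j) 1?eq_sym//= di dj big1// => k /andP[ki kj].
      by rewrite /d (negPf ki) (negPf kj).
    by rewrite addbF.
  apply: eq_big => [e|e _]; first by rewrite par.
  rewrite (bigD1 i)//= [in RHS](bigD1 i)//= -mulNr; congr (_ * _).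
    by rewrite ffunE /d eqxx mi !andbT addbT; case: (e i); rewrite ?opprK.
  apply: eq_bigr => k ki; rewrite ffunE /d (negPf ki) /=.
  by case: eqP => [->|_]; rewrite ?addbF// (negPf mj) !andbF.
have [h h2] := two; rewrite -[LHS]mul1r -h2 mulrAC mulrC.
by rewrite mulr_natl mulr2n {2}sE subrr mulr0.
Qed.

(** For a monomial with exponents of mixed parity the sign sum vanishes. Otherwise it is a monomial
    in the squares, times the product of the variables if the exponents are odd. The alternating sum
    of a monomial in the squares is a determinant, and reducing powers modulo the product of the
    [X - x_i ^ 2] factors [vdm] out, with cofactor in [S]. *)
Lemma antisym_vdm (S : P -> Prop) (u : P) : is_subring S -> (forall c, S c%:MP) ->
    (forall k, S (elsym (fun i : 'I_n => 'X_i ^+ 2) k)) -> S (\prod_i 'X_i) ->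
  exists2 p, S p & antisym u = vdm * p.
Proof.
move=> hS SC Se Sx; elim/mpolyind: u => [|c m u _ _ [p Sp pE]].
  exists 0; first exact: subring0.
  by rewrite mulr0 /antisym big1// => w _; rewrite rmorph0 mulr0.
suff [q Sq qE] : exists2 q, S q & antisym 'X_[m] = vdm * q.
  exists (c%:MP * q + p); first by apply: subringD => //; apply: subringM.
  by rewrite antisymD antisymZ qE pE mulrDr mul_mpolyC scalerAr.
have evenE (l : 'I_n -> nat) : exists2 q, S q &
    \sum_(s : 'S_n) (-1) ^+ (s : bool) * \prod_i ('X_(s i) ^+ 2) ^+ l i = vdm * q :> P.
  have /choice[C CP] := fun i => power_reduction hS (l i) Se.
  exists (\det (\matrix_(i, k) C i k)).
    by apply: subring_det => // i k; rewrite mxE; case: (CP i).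
  rewrite mulrC -det_mulmx; apply: eq_bigr => s _; congr (_ * _).
  apply: eq_bigr => i _; rewrite mxE; have [_ ->] := CP i.
  by apply: eq_bigr => k _; rewrite !mxE.
have [[b mb]|nb] := pselect (exists b, forall i, odd (m i) = b).
  have [q Sq qE] := evenE (fun i => (m i)./2).
  exists ((sign_sum m)%:MP * ((if b then \prod_i 'X_i else 1) * q)).
    by apply: subringM => //; apply: subringM => //; case: b {mb}; last exact: subring1.
  rewrite antisymX mulrCA mul_mpolyC mulrCA -qE; congr (_ *: _).
  rewrite mulr_sumr; apply: eq_bigr => s _; rewrite mulrCA; congr (_ * _).
  have -> : (if b then \prod_i 'X_i else 1) = \prod_i 'X_(s i) ^+ b :> P.
    case: b {mb}; last by rewrite big1.
    by rewrite [LHS](reindex_inj (@perm_inj _ s)).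
  rewrite -big_split; apply: eq_bigr => i _ /=.
  by rewrite -exprM -exprD -(mb i) mul2n odd_double_half.
exists 0; first exact: subring0.
have pick b : exists i, odd (m i) = b.
  apply: contrapT => ni; apply: nb; exists (~~ b) => i.
  by apply: contrapT => e; apply: ni; exists i; move: e; case: (odd _) (b) => -[].
have [[i mi] [j mj]] := (pick true, pick false).
by rewrite antisymX (@sign_sum_mixed _ i j) ?scale0r ?mulr0 ?mj.
Qed.

(* The left-hand components of [bs] span [P] over the invariants of [W]. *)
Lemma dual_basis : exists bs : seq (P * P), forall (z : P) (p : P -> P),
  (forall b, antisym (z * b) = vdm * p b) -> z = \sum_(b <- bs) b.1 * p b.2.
Proof.
have two0 : (2 : A) != 0.
  have [h h2] := two; apply/eqP => e; move: h2; rewrite e mul0r => /esym/eqP.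
  by rewrite oner_eq0.
have [D [[bs bsE] D1 D0]] := kernel n two0.
have [h h2] := two.
have [k kE] : exists k, \prod_(i < n) \prod_(j < n | (i < j)%N)
    ('X_i ^+ 2 - 'X_j ^+ 2) = (-1) ^+ k * vdm.
  rewrite /vdm det_Vandermonde.
  exists (\sum_(i < n) #|[pred j : 'I_n | (i < j)%N]|)%N.
  rewrite -prodrXr -big_split; apply: eq_bigr => i _ /=.
  by rewrite -prodrN; apply: eq_bigr => j _; rewrite !mxE opprB.
(* The inverse of the unit [2 ^ n (-1) ^ k] by which the kernel at the identity differs from
   [vdm]. *)
pose c : A := h ^+ n * (-1) ^+ k.
exists [seq (c%:MP * b.1, b.2) | b <- bs] => z p pE.
apply: lreg_vdm; rewrite big_map /=.
have c1 : c%:MP * (2 ^+ n * (-1) ^+ k) = 1 :> P.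
  rewrite /c mpolyCM !rmorphXn rmorphN1 mulrACA -exprMn -signr_odd -expr2 sqrr_sign mulr1.
  by rewrite -(rmorph_nat (@mpolyC n A) 2) -mpolyCM [h * _]mulrC h2 mpolyC1 expr1n.
transitivity (c%:MP * (z * D (sp1 n))).
  rewrite D1 kE; transitivity (c%:MP * (2 ^+ n * (-1) ^+ k) * (vdm * z)); last by ring.
  by rewrite c1 mul1r.
(* The other even [w] may be added, since [D w = 0] for them. *)
transitivity (c%:MP * \sum_(w : W | sp_even w) (-1) ^+ (w.1 : bool) * sp_act A w z * D w).
  congr (_ * _); have e1 : sp_even (sp1 n).
    by rewrite /sp_even big1// => i _; rewrite ffunE.
  rewrite (bigD1 (sp1 n))//= big1 => [|w /andP[we w1]].
    by rewrite addr0 odd_perm1 expr0 mul1r sp_act1.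
  by rewrite D0// mulr0.
under [in LHS]eq_bigr do rewrite bsE mulr_sumr.
rewrite exchange_big mulr_sumr mulr_sumr; apply: eq_bigr => b _ /=.
transitivity (c%:MP * b.1 * antisym (z * b.2)); last by rewrite pE; ring.
rewrite -mulrA; congr (_ * _); rewrite mulr_sumr; apply: eq_bigr => w _.
by rewrite [in RHS](rmorphM (sp_act A w)) mulrCA !mulrA.
Qed.

End Antisymmetrization.

(** * The splitting ring at a prime of the base *)

Section QuotientTheory.
Variables (R : comPzRingType) (X : set R).

Lemma quot_pi_eq x y : quot_pi X x = quot_pi X y <-> ideal_gen X (x - y).
Proof.
split=> [/eqP|/(introT (ideal_predP X _))].
  by rewrite /quot_pi -Quotient.idealrBE => /ideal_predP.
by rewrite Quotient.idealrBE => /eqP.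
Qed.

Lemma quot_pi_eq0 x : quot_pi X x = 0 <-> ideal_gen X x.
Proof. by rewrite -(rmorph0 (quot_pi X)) quot_pi_eq subr0. Qed.

Lemma quot_pi_surj (x : quot_gen X) : exists y, x = quot_pi X y.
Proof. by eexists; rewrite /quot_pi; symmetry; apply: reprK. Qed.

End QuotientTheory.

Lemma coef_prod_XsubC (n : nat) (S : comNzRingType) (h : 'I_n -> S) (k : nat) :
  (k <= n)%N -> (-1) ^+ k * elsym h k = (\prod_i ('X - (h i)%:P))`_(n - k).
Proof.
move=> kn; rewrite prod_XsubC_elsym coef_sum.
have kn' : (k < n.+1)%N by [].
rewrite (bigD1 (Ordinal kn'))//= big1 => [|i ik].
  by rewrite coefZ coefXn eqxx mulr1 addr0.
rewrite coefZ coefXn [_ == _]negbTE ?mulr0//; apply: contra ik => /eqP e.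
by apply/eqP/val_inj; rewrite /= -(subKn kn) e subKn// -ltnS.
Qed.

Section Integrality.
Variables (A : comNzRingType) (E : fieldType) (phi : {rmorphism A -> E}).

Lemma integral_prod (I : Type) (s : seq I) (F : I -> E) :
  (forall i, integralOver phi (F i)) -> integralOver phi (\prod_(i <- s) F i).
Proof. by move=> iF; apply: big_ind => //; [exact: integral1|exact: integral_mul]. Qed.

Lemma integral_exp (x : E) k : integralOver phi x -> integralOver phi (x ^+ k).
Proof. by move=> ix; rewrite -[k]card_ord -prodr_const; apply: integral_prod. Qed.

Lemma integral_mmap n (h : 'I_n -> E) (z : {mpoly A[n]}) :
  (forall i, integralOver phi (h i)) -> integralOver phi (mmap phi h z).
Proof.
move=> ih; apply: big_ind => [||m _]; [exact: integral0|exact: integral_add|].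
apply: integral_mul; first exact: integral_id.
by apply: integral_prod => i; apply: integral_exp.
Qed.

Lemma integral_sqrt (x : E) : integralOver phi (x ^+ 2) -> integralOver phi x.
Proof.
move=> ix; apply: (@integral_root_monic _ _ _ _ ('X^2 - (x ^+ 2)%:P)).
- exact: monicXnsubC.
- by rewrite /root !hornerE subrr.
apply/integral_poly => i; rewrite coefB coefXn coefC.
by apply: integral_sub; [exact: integral_nat|case: eqP => _ //; exact: integral0].
Qed.

(* Dividing a relation [q] by the largest possible power of ['X]. *)
Lemma root_inverse (q : {poly A}) : map_poly phi q != 0 ->
  exists s r, phi r != 0 /\
    forall v, v != 0 -> root (map_poly phi q) v -> v * (map_poly phi s).[v] = phi r.
Proof.
elim/poly_ind: q => [|q c IH]; first by rewrite map_poly0 eqxx.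
rewrite rmorphD rmorphM /= map_polyX map_polyC /=.
have [c0|c0] := eqVneq (phi c) 0.
  rewrite c0 addr0 => qX0; have [|s [r [r0 sr]]] := IH.
    by apply: contraNneq qX0 => ->; rewrite mul0r.
  exists s, r; split=> // v v0; rewrite rootM rootX (negPf v0) orbF; exact: sr.
move=> _; exists (- q), c; split=> // v v0.
rewrite /root hornerMXaddC addr_eq0 => /eqP e.
by rewrite rmorphN hornerN mulrN mulrC e opprK.
Qed.

End Integrality.

(** * Points of the splitting ring over [E] *)

Section Points.
Variables (A : comNzRingType) (n : nat) (f : {poly A}) (alpha : A).
Local Notation P := {mpoly A[n]}.
Local Notation I := (ideal_gen (@dsplit_gens A n f alpha)).

Definition is_scalar (z : P) : Prop := exists r, I (z - r%:MP).

Lemma mesym_squares k :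
  mesym n A k \mPo [tuple 'X_j ^+ 2 | j < n] = elsym (fun i : 'I_n => 'X_i ^+ 2 : P) k.
Proof.
rewrite /comp_mpoly mmap_mesym; apply: eq_bigr => s _.
by apply: eq_bigr => i _; rewrite tnth_mktuple.
Qed.

Lemma scalar_subring : is_subring is_scalar.
Proof.
have II := ideal_gen_ideal (@dsplit_gens A n f alpha); have [I0 ID IM] := II.
split=> [|x y [r xr] [s ys]|x y [r xr] [s ys]].
- by exists 1; rewrite mpolyC1 subrr.
- exists (r - s); rewrite mpolyCB.
  have -> : x - y - (r%:MP - s%:MP) = (x - r%:MP) - (y - s%:MP) by ring.
  exact: (ideal_sub II xr ys).
- exists (r * s); rewrite mpolyCM.
  have -> : x * y - r%:MP * s%:MP = x * (y - s%:MP) + s%:MP * (x - r%:MP) by ring.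
  by apply: ID; apply: IM.
Qed.

Lemma scalarC c : is_scalar c%:MP.
Proof. by exists c; rewrite subrr; case: (ideal_gen_ideal (@dsplit_gens A n f alpha)). Qed.

Lemma scalar_prod : is_scalar (\prod_i 'X_i).
Proof. by exists alpha; apply: sub_ideal_gen; right. Qed.

(** The relations give the degrees strictly between [0] and [n]; in degree [n] the value is the
    square of the product of the variables. *)
Lemma scalar_elsym k : is_scalar (elsym (fun i : 'I_n => 'X_i ^+ 2) k).
Proof.
have [->|k0] := posnP k; first by rewrite elsym0; apply: scalarC.
have [kn|] := ltnP k n.
  rewrite -[elsym _ k]mul1r -(sqrr_sign _ k) expr2 -mulrA.
  apply: (subringM scalar_subring); first exact: subring_sign scalar_subring _.
  exists (dcoef n f (2 * k)); rewrite -opprB -mesym_squares.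
  apply: (@ideal_opp _ I); first exact: ideal_gen_ideal.
  apply: sub_ideal_gen; left; exists k => //.
  by rewrite k0 -ltnS prednK// (ltn_trans k0).
rewrite leq_eqVlt => /orP[/eqP<-|nk].
  by rewrite elsymn prodrXl; apply: (subringM scalar_subring); apply: scalar_prod.
rewrite /elsym big1; first exact: scalarC 0.
move=> s /eqP sk; have := max_card (mem s); rewrite card_ord leqNgt.
by rewrite sk nk.
Qed.

Hypothesis gm : \sum_(i < n.+1) dcoef n f (2 * n - 2 * i) *: 'X^i \is monic.
Variables (E : fieldType) (phi : {rmorphism A -> E}) (eta : 'I_n -> E).
Hypothesis etaE : map_poly phi (\sum_(i < n.+1) dcoef n f (2 * n - 2 * i) *: 'X^i) =
  \prod_i ('X - (eta i ^+ 2)%:P).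
Hypothesis etaP : \prod_i eta i = phi alpha.

Definition ev0 : {rmorphism P -> E} := mmap phi eta.
(** Evaluation at the point [w eta]. *)
Definition ev (w : signed_perm n) : {rmorphism P -> E} := ev0 \o sp_act A w.

Lemma ev0C c : ev0 c%:MP = phi c. Proof. exact: mmapC. Qed.

Lemma evC w c : ev w c%:MP = phi c. Proof. by rewrite /= sp_actC ev0C. Qed.

Lemma evX w i : ev w 'X_i = (-1) ^+ w.2 i * eta (w.1 i).
Proof. by rewrite /= mmapX mmap1U mmapZ mmapX mmap1U rmorph_sign. Qed.

Lemma ev_sp1 z : ev (sp1 n) z = ev0 z. Proof. by rewrite /= sp_act1. Qed.

(** Every such [w eta] satisfies the relations: the [eta i ^ 2] are only permuted, and evenness
    preserves the product of the [eta i]. *)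
Lemma ev_ideal w z : sp_even w -> I z -> ev w z = 0.
Proof.
move=> we; move: z; apply: ideal_gen_min.
  split=> [|x y ex ey|x y ey]; rewrite /mkset.
  - exact: rmorph0.
  - by rewrite rmorphD ex ey addr0.
  - by rewrite rmorphM ey mulr0.
have ev_prod : ev w (\prod_i 'X_i) = phi alpha.
  transitivity (ev0 (\prod_i 'X_i)).
    rewrite -[in RHS](sp_var_even A we) /= !rmorph_prod; apply: eq_bigr => i _.
    by congr (ev0 _); apply: sp_actX.
  by rewrite -etaP rmorph_prod; apply: eq_bigr => i _; rewrite /= mmapX mmap1U.
move=> z [[k /andP[k0 kn] ->]|->]; rewrite /mkset rmorphB evC; last first.
  by rewrite ev_prod subrr.
have {}kn : (k <= n)%N by apply: leq_trans kn (leq_pred _).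
rewrite rmorphM rmorphXn rmorphN1 mesym_squares rmorph_elsym coef_prod_XsubC//.
apply/eqP; rewrite subr_eq0; apply/eqP.
transitivity ((\prod_i ('X - (eta i ^+ 2)%:P))`_(n - k)).
  rewrite -etaE coef_map coef_sum (bigD1 (rev_ord (Ordinal (kn : (k < n.+1)%N))))//=.
  rewrite big1 => [|i ik]; rewrite coefZ coefXn.
    by rewrite eqxx mulr1 addr0; congr (phi (dcoef _ _ _)); rewrite -mulnBr subKn.
  by rewrite [_ == _]negbTE ?mulr0//; apply: contra ik => /eqP e; apply/eqP/val_inj.
congr (nth _ _ _); congr polyseq; rewrite (reindex_inj (@perm_inj _ w.1)).
apply: eq_bigr => i _; congr ('X - _%:P); symmetry; transitivity (ev w 'X_i ^+ 2).
  exact: rmorphXn.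
by rewrite evX exprMn sqrr_sign mul1r.
Qed.

(* [D], [l] and [iota] stand for [A_p], the localization map and [A_p -> E]; [delta] is the
   discriminant, and [Dsq] says that it has valuation at most [1] at height one primes. *)
Variables (D : comNzRingType) (l : {rmorphism A -> D}) (iota : {rmorphism D -> E}).
Variables (p : Spec A) (delta : A) (e : nat).
Hypothesis two : is_unit (2 : A).
Hypothesis phiE : forall x, phi x = iota (l x).
Hypothesis iota_inj : injective iota.
Hypothesis lker : forall x, l x = 0 -> exists2 u, ~ p u & u * x = 0.
Hypothesis lsurj : forall z, exists x u, ~ p u /\ z * l u = l x.
Hypothesis Dic : integrally_closed D.
Hypothesis Ddom : is_domain D.
Hypothesis deltaE : phi delta = (-1) ^+ e * (ev0 (vdm A n)) ^+ 2.
Hypothesis delta0 : phi delta != 0.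
Hypothesis Dsq : forall a b : D, b != 0 -> (exists c, a ^+ 2 * l delta = c * b ^+ 2) ->
  exists c, a = c * b.

(** The [p_b] of the overview, replaced by constants [r b] of [A] congruent to them; the second
    clause determines their values in [E]. *)
Let coordinates : exists bs : seq (P * P), forall z, exists r : P -> A,
  I (z - \sum_(b <- bs) b.1 * (r b.2)%:MP) /\
  forall b, ev0 (vdm A n) * phi (r b) =
    \sum_(w : signed_perm n | sp_even w) (-1) ^+ (w.1 : bool) * ev w (z * b).
Proof.
have [bs bsP] := dual_basis n two; exists bs => z.
have /choice[q qP] : forall b, exists q, is_scalar q /\ antisym (z * b) = vdm A n * q.
  move=> b; have [q Sq qE] :=
    antisym_vdm two (z * b) scalar_subring scalarC scalar_elsym scalar_prod.
  by exists q.
have /choice[r rP] : forall b, exists r, I (q b - r%:MP) by move=> b; case: (qP b).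
exists r; split.
  rewrite (bsP z q) => [|b]; last by case: (qP b).
  rewrite -sumrB; apply: ideal_sum => [|b _]; first exact: ideal_gen_ideal.
  rewrite -mulrBr; have [_ _] := ideal_gen_ideal (@dsplit_gens A n f alpha).
  exact.
move=> b; have sp1e : sp_even (sp1 n).
  by rewrite /sp_even big1// => i _; rewrite ffunE.
have -> : phi (r b) = ev0 (q b).
  have := ev_ideal sp1e (rP b); rewrite ev_sp1 rmorphB ev0C => /eqP.
  by rewrite subr_eq0 => /eqP.
have [_ qE] := qP b; rewrite -rmorphM -qE rmorph_sum; apply: eq_bigr => w _.
by rewrite rmorphM rmorph_sign.
Qed.

Let p1 : ~ p 1. Proof. exact: prime_proper. Qed.

Let common_multiple (T : eqType) (bs : seq T) (u : T -> A) : (forall b, ~ p (u b)) ->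
  exists2 t, ~ p t & forall b, b \in bs -> exists v, t = v * u b.
Proof.
move=> nu; exists (\prod_(b <- bs) u b).
  by apply: (big_ind (fun x => ~ p x)) => [|x y|b _]; [exact: p1|exact: prime_mul|exact: nu].
by move=> b bbs; rewrite (big_rem _ bbs)/=; eexists; rewrite mulrC.
Qed.

Let vdm0 : ev0 (vdm A n) != 0.
Proof. by apply: contraNneq delta0; rewrite deltaE => ->; rewrite expr0n mulr0. Qed.

Let ker_phi x : phi x = 0 -> exists2 u, ~ p u & u * x = 0.
Proof. by rewrite phiE -(rmorph0 iota) => /iota_inj/lker. Qed.

Let IM x y : I y -> I (x * y).
Proof. by have [_ _] := ideal_gen_ideal (@dsplit_gens A n f alpha); apply. Qed.

(** Since [vdm] is nonzero at [eta], all coordinates of [z] have value [0] in [E], so they die in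
    [A_p]. Thus [B] localized at [p] embeds into the [E]-valued functions on even signed
    permutations. *)
Lemma ev_eq0 z : (forall w, sp_even w -> ev w z = 0) -> exists2 t, ~ p t & I (t%:MP * z).
Proof.
move=> z0; have [bs /(_ z)[r [rI rE]]] := coordinates.
have /choice[u uP] : forall b, exists u, ~ p u /\ u * r b = 0.
  move=> b; have [|u nu e0] := @ker_phi (r b); last by exists u.
  apply: (mulfI vdm0); rewrite rE mulr0 big1// => w we.
  by rewrite rmorphM z0// mul0r mulr0.
have [t nt tE] := common_multiple bs (u := fun b => u b.2) (fun b => (uP b.2).1).
exists t => //; suff <- : t%:MP * (z - \sum_(b <- bs) b.1 * (r b.2)%:MP) = t%:MP * z.
  exact: IM.
rewrite mulrBr [X in _ - X]mulr_sumr big_seq big1 ?subr0// => b /tE[v ->].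
by rewrite mulrCA -mpolyCM -mulrA (uP b.2).2 mulr0 mpolyC0 mulr0.
Qed.

Let integral_local x : integralOver phi x -> integralOver iota x.
Proof.
move=> [q qm qx]; exists (map_poly l q); first exact: monic_map.
rewrite -map_poly_comp; suff -> : map_poly (iota \o l) q = map_poly phi q by [].
by apply: eq_map_poly => c; rewrite phiE.
Qed.

Lemma integral_ev w z : integralOver phi (ev w z).
Proof.
have ieta i : integralOver phi (eta i).
  apply: integral_sqrt; exists (\sum_(i < n.+1) dcoef n f (2 * n - 2 * i) *: 'X^i).
    exact: gm.
  by rewrite etaE /root horner_prod (bigD1 i)//= hornerXsubC subrr mul0r.
exact: integral_mmap.
Qed.

(** For a coordinate [s b] of [c], the product of [vdm] at [eta] and [k = s b / r] is a sum of
    integral elements. Its square is [k ^ 2 delta] up to sign, which lies in [A_p] by normality;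
    [Dsq] then puts [k] in [A_p], and denominators are cleared. *)
Lemma integral_quotient c r : phi r != 0 ->
    (forall w, sp_even w -> integralOver iota (ev w c / phi r)) ->
  exists t c', ~ p t /\ I (t%:MP * c - r%:MP * c').
Proof.
move=> r0 ic; have [bs /(_ c)[s [sI sE]]] := coordinates.
have lr0 : l r != 0 by apply: contraNneq r0; rewrite phiE => ->; rewrite rmorph0.
have /choice[u uP] : forall b, exists u, ~ p u.1 /\ u.1 * s b = u.2 * r.
  move=> b.
  have iv : integralOver iota (ev0 (vdm A n) * (phi (s b) / phi r)).
    rewrite mulrA sE mulr_suml; apply: big_ind => [||w we].
    - exact: integral0.
    - exact: integral_add.
    rewrite rmorphM -mulrA; apply: integral_mul.
      by rewrite -(rmorph_sign iota); apply: integral_id.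
    rewrite mulrAC; apply: integral_mul; first exact: ic.
    exact/integral_local/integral_ev.
  have [|k kE] := Dsq (a := l (s b)) lr0.
    have lr20 : l r ^+ 2 != 0.
      by apply: contraNneq r0 => lr; rewrite phiE -sqrf_eq0 -rmorphXn lr rmorph0.
    apply: (integrally_closed_frac (z := phi delta * (phi (s b) / phi r) ^+ 2) Dic
      iota_inj (domain_lreg Ddom lr20)).
      rewrite rmorphXn rmorphM rmorphXn -!phiE -mulrA -exprMn divfK// mulrC.
      done.
    rewrite deltaE -mulrA -exprMn; apply: integral_mul.
      by rewrite -(rmorphN1 iota) -rmorphXn; apply: integral_id.
    by rewrite expr2; apply: integral_mul.
  have [x [v [nv vx]]] := lsurj k.
  have [y ny e0] : exists2 y, ~ p y & y * (v * s b - x * r) = 0.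
    by apply: lker; rewrite rmorphB !rmorphM kE -vx; ring.
  exists (y * v, y * x); split; first exact: prime_mul.
  by apply/eqP; rewrite -subr_eq0 -!mulrA -mulrBr e0.
have [t nt tE] := common_multiple bs (u := fun b => (u b.2).1) (fun b => (uP b.2).1).
have /choice[v vE] : forall b, exists v, b \in bs -> t = v * (u b.2).1.
  move=> b; have [/tE[v e0]|nb] := boolP (b \in bs); first by exists v.
  by exists 0.
exists t, (\sum_(b <- bs) b.1 * (v b * (u b.2).2)%:MP); split=> //.
suff -> : t%:MP * c - r%:MP * (\sum_(b <- bs) b.1 * (v b * (u b.2).2)%:MP) =
    t%:MP * (c - \sum_(b <- bs) b.1 * (s b.2)%:MP) by apply: IM.
rewrite mulrBr; congr (_ - _); rewrite !mulr_sumr big_seq [RHS]big_seq.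
apply: eq_bigr => b /vE ->; have [_ ub] := uP b.2.
rewrite mulrCA [RHS]mulrCA -!mpolyCM; congr (_ * _%:MP).
by rewrite -[RHS]mulrA ub; ring.
Qed.

(** One polynomial, the product of integral equations of all the [ev w y], serves every [w];
    [root_inverse] then yields [y'] as a polynomial in [y]. *)
Lemma quasi_inverse y : exists y' r, phi r != 0 /\
  forall w, sp_even w -> ev w y != 0 -> ev w y * ev w y' = phi r.
Proof.
have /choice[q qP] : forall w, exists q, q \is monic /\ root (map_poly phi q) (ev w y).
  by move=> w; have [q] := integral_ev w y; exists q.
have [|s [r [r0 sr]]] := @root_inverse _ _ phi (\prod_w q w).
  rewrite monic_neq0//; apply: monic_map; apply: monic_prod => w _.
  by case: (qP w).
exists (map_poly (@mpolyC n A) s).[y], r; split=> // w _ y0.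
rewrite -(sr (ev w y))//; last first.
  by rewrite rmorph_prod (bigD1 w)//= rootM; case: (qP w) => _ ->.
congr (_ * _); rewrite -horner_map -map_poly_comp.
by congr (_.[_]); apply: eq_map_poly => c; rewrite /= sp_actC ev0C.
Qed.

(* [e' / t] is the idempotent of the total ring of fractions supported where [y <> 0]; it is
   integral, hence comes from [B] localized at [p]. *)
Lemma support_idempotent y : exists y' r e' t,
  [/\ ~ p t, phi r != 0,
      forall w, sp_even w -> ev w y != 0 -> ev w y * ev w y' = phi r /\ ev w e' = phi t
    & forall w, sp_even w -> ev w y = 0 -> ev w e' = 0].
Proof.
have [y' [r [r0 yy']]] := quasi_inverse y.
(* The fraction [y y' / r] takes only the values [0] and [1], so it is integral. *)
have [w we|t [e' [nt]]] := @integral_quotient (y * y') r r0.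
  rewrite rmorphM; have [->|y0] := eqVneq (ev w y) 0.
    by rewrite !mul0r; apply: integral0.
  by rewrite yy'// divff//; apply: integral1.
move=> eI; have eE w : sp_even w -> phi r * ev w e' = phi t * (ev w y * ev w y').
  move=> we; have := ev_ideal we eI; rewrite rmorphB !rmorphM !evC => /eqP.
  by rewrite subr_eq0 => /eqP.
exists y', r, e', t; split=> // w we y0.
  split; first exact: yy'.
  by apply: (mulfI r0); rewrite eE// yy'// mulrC.
by apply: (mulfI r0); rewrite eE// y0 mul0r !mulr0.
Qed.

Variable Q : Spec (DSplit n f alpha).
Local Notation pi := (quot_pi (@dsplit_gens A n f alpha) : P -> DSplit n f alpha).
Local Notation L := (to_local Q).
Hypothesis Qp : forall a, p a <-> Q (pi a%:MP).

Variable loc_pi : {rmorphism P -> local_ring Q}.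
Hypothesis loc_piE : forall z, loc_pi z = L (pi z).

Let loc_pi_ev z : (forall w, sp_even w -> ev w z = 0) -> loc_pi z = 0.
Proof.
move=> /ev_eq0[t nt tI]; rewrite loc_piE; apply/to_local_eq0; exists (pi t%:MP).
  by rewrite -Qp.
by have /quot_pi_eq0 := tI; rewrite rmorphM.
Qed.

Let loc_pi_unit z : ~ Q (pi z) -> is_unit (loc_pi z).
Proof. by rewrite loc_piE; apply: to_local_unit. Qed.

Let loc_surj_pi x : exists z u, ~ Q (pi u) /\ x * loc_pi u = loc_pi z.
Proof.
have [y [s [ns e0]]] := to_local_surj x.
have [z yz] := quot_pi_surj y; have [u su] := quot_pi_surj s.
by exists z, u; split; [rewrite -su|rewrite !loc_piE -yz -su].
Qed.

Let loc_pi_eq0 z : loc_pi z = 0 -> exists2 u, ~ Q (pi u) & I (u * z).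
Proof.
rewrite loc_piE => /to_local_eq0[s ns e0]; have [u su] := quot_pi_surj s.
exists u; first by rewrite -su.
by apply/quot_pi_eq0; rewrite su in e0; rewrite rmorphM.
Qed.

Let unit_mul0 (R : comPzRingType) (u x : R) : is_unit u -> x * u = 0 -> x = 0.
Proof. by move=> [v uv] xu; rewrite -[x]mulr1 -uv mulrA xu mul0r. Qed.

Let scalar_nmem t : ~ p t -> ~ Q (pi t%:MP).
Proof. by rewrite Qp. Qed.

Let mem_sub x y : Q (pi x) -> Q (pi (y - x)) -> Q (pi y).
Proof.
move=> qx; rewrite rmorphB => qyx; rewrite -[pi y](subrK (pi x)).
by have [_ + _] := prime_ideal Q; apply.
Qed.

(** Let [E' / t] be the idempotent on the support of the numerator [X] of [x]. Then [t - E'] kills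
    [X] and, up to a unit, [E'] kills the numerator of [y]; as [t] is not in [Q], one of [E'] and
    [t - E'] is a unit in the local ring. *)
Lemma dsplit_local_domain : is_domain (local_ring Q).
Proof.
move=> x y xy; have [X [s [ns xX]]] := loc_surj_pi x.
have [Y [s' [ns' yY]]] := loc_surj_pi y.
have [U nU UI] : exists2 U, ~ Q (pi U) & I (U * (X * Y)).
  by apply: loc_pi_eq0; rewrite rmorphM -xX -yY mulrACA xy mul0r.
have [X' [r [E' [t [nt r0 Xn0 X0]]]]] := support_idempotent X.
have tX : loc_pi ((t%:MP - E') * X) = 0.
  apply: loc_pi_ev => w we; rewrite rmorphM rmorphB evC.
  have [->|x0] := eqVneq (ev w X) 0; first by rewrite mulr0.
  by have [_ ->] := Xn0 w we x0; rewrite subrr mul0r.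
have EY : loc_pi (E' * U * Y) = 0.
  apply: loc_pi_ev => w we; rewrite !rmorphM.
  have [x0|x0] := eqVneq (ev w X) 0; first by rewrite (X0 w we x0) !mul0r.
  have := ev_ideal we UI; rewrite !rmorphM mulrCA => /eqP.
  by rewrite mulf_eq0 (negPf x0) -mulrA => /eqP->; rewrite mulr0.
have [QE|nQE] := pselect (Q (pi E')).
  left; apply: (unit_mul0 (loc_pi_unit ns)); rewrite xX.
  rewrite mulrC rmorphM in tX; apply: unit_mul0 tX; apply: loc_pi_unit.
  by move=> Qt; apply: (scalar_nmem nt); apply: mem_sub Qt.
right; apply: (unit_mul0 (loc_pi_unit ns')); rewrite yY.
rewrite mulrC rmorphM in EY; apply: unit_mul0 EY; apply: loc_pi_unit.
by rewrite rmorphM; apply: prime_mul.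
Qed.

(* Clearing the denominators of the coefficients of an integral equation of
   [loc_pi X / loc_pi Y]. *)
Let integral_relation (q : {poly local_ring Q}) X Y : q \is monic ->
    hom_eval q (loc_pi X) (loc_pi Y) = 0 ->
  exists s u (d : nat -> P) m, [/\ ~ Q (pi s), ~ Q (pi u) &
    I (u * ((s * X) ^+ m + \sum_(i < m) d i * ((s * X) ^+ i * Y ^+ (m - i))))].
Proof.
move=> qm qXY; pose m := (size q).-1.
have qs : size q = m.+1 by rewrite /m prednK// size_poly_gt0 monic_neq0.
have /choice[g gP] : forall i, exists zu : P * P,
    ~ Q (pi zu.2) /\ q`_i * loc_pi zu.2 = loc_pi zu.1.
  by move=> i; have [z [u [nu e0]]] := loc_surj_pi q`_i; exists (z, u).
pose s := \prod_(i < m) (g i).2.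
have ns : ~ Q (pi s).
  rewrite rmorph_prod; apply: (big_ind (fun x => ~ Q x)) => [|x y|i _].
  - exact: prime_proper.
  - exact: prime_mul.
  - by case: (gP i).
have /choice[d dE] : forall i, exists z, (i < m)%N -> q`_i * loc_pi s = loc_pi z.
  move=> i; have [im|_] := ltnP i m; last by exists 0.
  exists ((g i).1 * \prod_(j < m | j != Ordinal im) (g j).2) => _.
  rewrite /s (bigD1 (Ordinal im))//= !rmorphM mulrA; congr (_ * _).
  by case: (gP i).
(* Multiplying the equation by [s ^ m] gives a monic one for [s X]; one factor of [s ^ (m - i)] is
   spent on the denominator of the coefficient of [q]. *)
pose c i := d i * s ^+ (m - i).-1.
have [|u nu uI] := @loc_pi_eq0 ((s * X) ^+ m + \sum_(i < m) c i * ((s * X) ^+ i * Y ^+ (m - i))).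
  have := congr1 (fun z => loc_pi s ^+ m * z) qXY; rewrite mulr0 => <-.
  rewrite rmorphD rmorph_sum /hom_eval qs big_ord_recr /= subnn expr0 mulr1.
  have -> : q`_m = 1 by have /monicP := qm; rewrite lead_coefE.
  rewrite mul1r mulrDr addrC rmorphXn rmorphM exprMn; congr (_ + _).
  rewrite mulr_sumr; apply: eq_bigr => i _.
  rewrite /c !rmorphM !rmorphXn. rewrite rmorphM -(dE _ (ltn_ord i)) exprMn.
  have -> : loc_pi s ^+ m = loc_pi s * loc_pi s ^+ (m - i).-1 * loc_pi s ^+ i.
    by rewrite -exprS prednK ?subn_gt0// -exprD subnK// ltnW.
  have ac (R : comPzRingType) (a b x y z v : R) :
      a * b * x * (y * z * v) = b * x * y * (a * (z * v)).
    by ring.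
  exact: ac.
by exists s, u, c, m.
Qed.

(** Write [z = X / Y'], with an integral relation for [s X / Y'] that holds after multiplication by
    [u]. The fraction [E' u s X Z / r] is [0] at the points where [Y'] vanishes and [t u (s X / Y')]
    at the others, hence integral; [integral_quotient] supplies [c'] with [z = c' / (t' E' u s)]. *)
Lemma dsplit_local_integrally_closed : integrally_closed (local_ring Q).
Proof.
move=> z [q qm qz]; have [a [b [rb zb]]] := loc_surj z.
have [Y [s1 [ns1 bY]]] := loc_surj_pi b; have [X0 [s2 [ns2 aX]]] := loc_surj_pi a.
pose lm : {rmorphism local_ring Q -> loc (regulars (local_ring Q))} :=
  @loc_map (local_ring Q) (regulars (local_ring Q)).
set X := X0 * s1; set Y' := Y * s2.
have zXY : z * lm (loc_pi Y') = lm (loc_pi X).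
  have lmM x y : lm (x * y) = lm x * lm y by exact: rmorphM.
  have zb' : z * lm b = lm a by exact: zb.
  by rewrite !(rmorphM loc_pi) -aX -bY !lmM !mulrA zb' mulrAC.
have Y0 : loc_pi Y' != 0.
  apply/eqP => Y0; have : b = 0.
    apply: (unit_mul0 (u := loc_pi (s1 * s2))); last by rewrite rmorphM mulrA bY -rmorphM.
    by apply: loc_pi_unit; rewrite rmorphM; apply: prime_mul.
  by move=> b0; move: rb; rewrite b0; apply: (@regular0 (local_ring Q)).
clearbody X Y'.
have rY : GRing.lreg (loc_pi Y') by apply: domain_lreg Y0; apply: dsplit_local_domain.
have h0 : hom_eval q (loc_pi X) (loc_pi Y') = 0.
  apply: (@loc_regulars_inj (local_ring Q)).
  by rewrite (hom_evalE _ (f := lm) zXY) (rootP qz) mulr0 rmorph0.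
have [s [u [d [m [ns nu rel]]]]] := integral_relation qm h0.
have [Z [r [E' [t [nt r0 Yn0 Yeq0]]]]] := support_idempotent Y'.
have [w we|t' [c' [nt' cI]]] := @integral_quotient (E' * u * (s * X) * Z) r r0.
  rewrite !rmorphM; have [y0|y0] := eqVneq (ev w Y') 0.
    by rewrite (Yeq0 w we y0) !mul0r; apply: integral0.
  have [yz ->] := Yn0 w we y0.
  pose v := ev w s * ev w X / ev w Y'.
  have vY : v * ev w Y' = ev w s * ev w X by rewrite divfK.
  suff iv : integralOver phi (phi t * (ev w u * v)).
    rewrite [X in integralOver _ X](_ : _ = phi t * (ev w u * v)); first exact: integral_local.
    have z0 : ev w Z != 0 by apply: contraNneq r0 => z0; rewrite -yz z0 mulr0.
    by rewrite /v -yz; field; rewrite y0 z0.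
  apply: integral_mul; first exact: integral_id.
  (* At points where [u] vanishes the relation gives nothing, but there the element is [0]. *)
  have [->|u0] := eqVneq (ev w u) 0; first by rewrite mul0r; apply: integral0.
  apply: integral_mul; first exact: integral_ev.
  have := ev_ideal we rel; rewrite (rmorphM (ev w)) (rmorphD (ev w)) (rmorph_sum (ev w)) => /eqP.
  rewrite mulf_eq0 (negPf u0) orFb => /eqP rel0.
  pose g := 'X^m + \poly_(i < m) ev w (d i).
  have sg : (size (\poly_(i < m) ev w (d i)) < size ('X^m : {poly E}))%N.
    by rewrite size_polyXn ltnS size_poly.
  apply: (@integral_root_monic _ _ _ _ g).
  - by rewrite monicE lead_coefDl// lead_coefXn.
  - rewrite /root /g hornerD hornerXn horner_poly; apply/eqP.
    apply: (mulfI (expf_neq0 m y0)); rewrite mulr0 -[RHS]rel0 mulrDr; congr (_ + _).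
      by rewrite -exprMn [_ * v]mulrC vY (rmorphXn (ev w)) (rmorphM (ev w)).
    rewrite mulr_sumr; apply: eq_bigr => i _.
    rewrite !(rmorphM (ev w)) !(rmorphXn (ev w)) (rmorphM (ev w)) mulrCA; congr (_ * _).
    have -> : ev w Y' ^+ m = ev w Y' ^+ (m - i) * ev w Y' ^+ i.
      by rewrite -exprD subnK// ltnW.
    rewrite -mulrA -exprMn.
    by rewrite [ev w Y' * v]mulrC vY mulrC.
  - apply/integral_poly => i; rewrite coefD coefXn coef_poly.
    apply: integral_add; first exact: integral_nat.
    by case: ifP => _; [exact: integral_ev|exact: integral0].
have eqXY : loc_pi (t'%:MP * (E' * u * s) * X) = loc_pi (c' * Y').
  apply/eqP; rewrite -subr_eq0 -rmorphB; apply/eqP; apply: loc_pi_ev => w we.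
  have := ev_ideal we cI; rewrite !rmorphB !rmorphM !evC => /eqP; rewrite subr_eq0 => /eqP cE.
  apply/eqP; rewrite subr_eq0; apply/eqP.
  have [y0|y0] := eqVneq (ev w Y') 0.
    by rewrite (Yeq0 w we y0) y0 !(mul0r, mulr0).
  have [yz _] := Yn0 w we y0.
  apply: (mulfI r0); rewrite [RHS]mulrA -cE -yz; ring.
(* If [E'] were in [Q], then [t - E'] would be a unit annihilating the nonzero [Y']. *)
have nE : ~ Q (pi E').
  move=> QE; move/eqP: Y0; apply.
  have tY : loc_pi ((t%:MP - E') * Y') = 0.
    apply: loc_pi_ev => w we; rewrite rmorphM rmorphB evC.
    have [->|y0] := eqVneq (ev w Y') 0; first by rewrite mulr0.
    by have [_ ->] := Yn0 w we y0; rewrite subrr mul0r.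
  rewrite mulrC rmorphM in tY; apply: unit_mul0 tY; apply: loc_pi_unit.
  by move=> Qt; apply: (scalar_nmem nt); apply: mem_sub Qt.
have [g gu] : is_unit (loc_pi (t'%:MP * (E' * u * s))).
  apply: loc_pi_unit; rewrite !rmorphM.
  by apply: prime_mul (scalar_nmem nt') _; do 2?apply: prime_mul.
exists (g * loc_pi c').
have [y yY] := loc_map_unit (rY : regulars (local_ring Q) (loc_pi Y')).
have XE : loc_pi X = g * loc_pi c' * loc_pi Y'.
  by rewrite -mulrA -rmorphM -eqXY rmorphM mulrA [g * _]mulrC gu mul1r.
rewrite -[LHS]mulr1 -yY mulrA zXY XE rmorphM -mulrA.
by rewrite [X in _ * X]yY mulr1.
Qed.

End Points.

(** * Contraction of primes and conclusion *)

Section Contraction.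
Variables (R S : comPzRingType) (g : {rmorphism R -> S}) (Q : Spec S).

Fact contraction_ideal : is_ideal [set x | Q (g x)].
Proof.
have [Q0 QD QM] := prime_ideal Q; split; rewrite /mkset.
- by rewrite rmorph0.
- by move=> x y Qx Qy; rewrite rmorphD; apply: QD.
- by move=> x y Qy; rewrite rmorphM; apply: QM.
Qed.

Fact contraction_proper : ~ [set x | Q (g x)] 1.
Proof. by rewrite /mkset rmorph1; apply: prime_proper. Qed.

Fact contraction_prime x y :
  [set x | Q (g x)] (x * y) -> [set x | Q (g x)] x \/ [set x | Q (g x)] y.
Proof. by rewrite /mkset rmorphM => /primeM. Qed.

Definition contraction : Spec R :=
  MkSpec contraction_ideal contraction_proper contraction_prime.

End Contraction.

Theorem proposition3p8 (A : comNzRingType) (hA : noetherian A)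
    (h2 : is_unit (2 : A)) (n : nat) (hn : (1 <= n)%N)
    (a : nat -> A) (ha0 : a 0%N = 1)
    (f : {poly A})
    (hf : f = \sum_(i < n.+1) a (2 * n - 2 * i)%N *: 'X^(2 * i))
    (alpha : A) (halpha : alpha ^+ 2 = (-1) ^+ n * a (2 * n)%N)
    (hnormal : normal_ring A)
    (hreg : GRing.lreg (reduced_disc n f alpha))
    (hcodim : codim_ge (sing_locus (reduced_disc n f alpha)) 2) :
  squarefree (reduced_disc n f alpha) /\ normal_ring (DSplit n f alpha).
Proof.
split; first exact: normal_squarefree.
move=> Q; pose X := @dsplit_gens A n f alpha.
pose p := contraction (quot_pi X \o @mpolyC n A : {rmorphism A -> quot_gen X}) Q.
have [dD ic] := hnormal p; pose l := to_local p.
(* The polynomial with [f(u) = g(u^2)]; its discriminant is [tilde_disc]. *)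
pose g : {poly A} := \sum_(i < n.+1) dcoef n f (2 * n - 2 * i) *: 'X^i.
have gE : g = \poly_(i < n.+1) a (2 * n - 2 * i)%N.
  rewrite poly_def; apply: eq_bigr => i _; congr (_ *: _).
  have in2 : (2 * i <= 2 * n)%N by rewrite leq_mul2l /= -ltnS.
  rewrite /dcoef subKn// hf coef_sum (bigD1 i)//= big1 => [|j ji].
    by rewrite coefZ coefXn eqxx mulr1 addr0.
  rewrite coefZ coefXn eqn_mul2l /= [_ == _]negbTE ?mulr0//.
  by rewrite eq_sym.
have gn : g`_n = 1 by rewrite gE coef_poly ltnSn subnn.
have sg : size g = n.+1 by rewrite gE size_poly_eq// subnn ha0 oner_eq0.
have gm : g \is monic by rewrite monicE lead_coefE sg gn.
pose phi0 : {rmorphism A -> fracfield dD} := to_frac dD \o l.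
have [||||E [h [eta [etaE etaP]]]] :=
    @square_splitting_field _ n (map_poly phi0 g) (phi0 alpha) => //.
- exact: monic_map.
- by rewrite size_map_poly_id0 ?(monicP gm) ?rmorph1 ?oner_eq0.
- rewrite -(rmorphXn phi0) halpha (rmorphM phi0) (rmorphXn phi0) (rmorphN1 phi0).
  by rewrite coef_map gE coef_poly muln0 subn0.
pose iota : {rmorphism local_ring p -> E} := h \o to_frac dD.
pose phi : {rmorphism A -> E} := iota \o l.
have iota_inj : injective iota.
  by apply: inj_comp; [exact: fmorph_inj|exact: to_frac_inj].
have phig : map_poly phi g = \prod_i ('X - (eta i ^+ 2)%:P).
  by rewrite -etaE -map_poly_comp.
have [e eE] := discriminant_roots hn gm phig.
have eE' : phi (tilde_disc n f) = (-1) ^+ e * ev0 phi eta (vdm A n) ^+ 2.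
  rewrite [LHS]eE /vdm -det_map_mx; congr (_ * \det _ ^+ 2).
  apply/matrixP => i j; rewrite !mxE; symmetry.
  by rewrite !(rmorphXn (ev0 phi eta)) /= mmapX mmap1U.
have d0 : phi (tilde_disc n f) != 0.
  (* A regular element is killed by nothing outside [p], so [reduced_disc] is nonzero in [A_p], and
     so is its factor [tilde_disc]. *)
  have : phi (reduced_disc n f alpha) != 0.
    rewrite -(rmorph0 phi) (inj_eq iota_inj) rmorph0; apply/eqP => /to_local_eq0[u nu].
    rewrite mulrC -[RHS](mulr0 (reduced_disc n f alpha)) => /hreg u0.
    by apply: nu; rewrite u0; case: (prime_ideal p).
  by apply: contraNneq => d0; rewrite /reduced_disc rmorphM d0 mulr0.
pose lp : {rmorphism {mpoly A[n]} -> local_ring Q} := to_local Q \o quot_pi X.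
have lpE z : lp z = to_local Q (quot_pi X z) by [].
have Qp b : p b <-> Q (quot_pi X b%:MP) by [].
have lker x : l x = 0 -> exists2 u, ~ p u & u * x = 0 by move/to_local_eq0.
(* The square criterion is used for the factor [tilde_disc], with cofactor [4 ^ n alpha]. *)
have Dsq := square_denominator hA hnormal hcodim (p := p)
  (erefl : reduced_disc n f alpha = (4 ^+ n * alpha) * tilde_disc n f).
split.
  exact: (dsplit_local_domain gm phig etaP h2 (fun=> erefl) iota_inj lker
    (@to_local_surj _ p) ic dD eE' d0 Dsq Qp lpE).
exact: (dsplit_local_integrally_closed gm phig etaP h2 (fun=> erefl) iota_inj lker
  (@to_local_surj _ p) ic dD eE' d0 Dsq Qp lpE).
Qed.
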